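(* Let $m_1,\dots,m_k,n_1,\dots,n_r$ be positive integers and $\mathcal{R}=\{(t_1,\dots,t_k,s_1,\dots,s_r)\in\mathbb{R}_{\ge0}^{k+r}:\sum_{i=1}^km_it_i=\sum_{j=1}^rn_js_j\}$. Let $(Y,\nu)$ be a probability space and $F:Y\times\mathbb{R}_{\ge0}^{k+r}\to\mathbb{R}$ a bounded measurable function. Suppose there exist $\delta>0$ and $C>0$ such that for all $h_1,h_2\in\mathcal{R}$, $$\Big|\int_YF(x,h_1)F(x,h_2)\,d\nu(x)\Big|\le Ce^{-\delta\min\{\lfloor h_1\rfloor,\lfloor h_2\rfloor,\|h_1-h_2\|_\infty\}}.$$ Then, given $\epsilon>0$, for $\nu$-almost every $y\in Y$, $$\frac{1}{T^{k+r-1}}\int_{J^T}F(y,h)\,dh=\begin{cases}o\big(T^{-1}(\log T)^{\frac32+r+\epsilon}\big),& r+k>2,\\ o\big(T^{-1/2}(\log T)^{\frac32+\epsilon}\big),&r+k=2,\end{cases}$$ as $T\to\infty$, where $J^T=\{(t_1,\dots,t_k,s_1,\dots,s_r)\in\mathcal{R}:s_i\le T\ \forall i\}$.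
   Context: For $h=(h_1,\dots,h_{k+r})\in\mathbb{R}^{k+r}$, $\lfloor h\rfloor=\min\{|h_1|,\dots,|h_{k+r}|\}$. The integral $dh$ over $J^T\subset\mathcal{R}$ is with respect to the $(k+r-1)$-dimensional Lebesgue measure on the hyperplane containing $\mathcal{R}$. *)

(* Defs.v *)
From HB Require Import structures.
From mathcomp Require Import all_boot all_order all_algebra.
From mathcomp Require Import all_classical all_reals all_analysis.
Set Implicit Arguments. Unset Strict Implicit. Unset Printing Implicit Defensive.
Import Order.TTheory GRing.Theory Num.Theory.
Import numFieldNormedType.Exports.
Local Open Scope classical_set_scope.
Local Open Scope ring_scope.

Section Defs.
Variable R : realType.

(* floor h = min_i |h_i| (0 for the empty tuple, which never occurs here) *)
Definition floorv (d : nat) (h : d.-tuple R) : R :=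
  let s := [seq `|x| | x <- tval h] in foldr Num.min (head 0 s) s.

Definition supdist (d : nat) (h1 h2 : d.-tuple R) : R :=
  \big[Num.max/0]_(i < d) `|tnth h1 i - tnth h2 i|.

Definition tcoord (k r : nat) (h : (k + r).-tuple R) (i : 'I_k) : R :=
  tnth h (lshift r i).
Definition scoord (k r : nat) (h : (k + r).-tuple R) (j : 'I_r) : R :=
  tnth h (rshift k j).

Definition inRcone (k r : nat) (m : 'I_k -> nat) (n : 'I_r -> nat)
  (h : (k + r).-tuple R) : Prop :=
  (forall i, 0 <= tnth h i) /\
  \sum_(i < k) (m i)%:R * tcoord h i = \sum_(j < r) (n j)%:R * scoord h j.

Definition inJT (k r : nat) (m : 'I_k -> nat) (n : 'I_r -> nat) (T : R)
  (h : (k + r).-tuple R) : Prop :=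
  inRcone m n h /\ forall j, scoord h j <= T.

(* The hyperplane is { h : sum_i w_i h_i = 0 } with weights w = (m, -n). *)
Definition weight (k r : nat) (m : 'I_k -> nat) (n : 'I_r -> nat)
  (i : 'I_(k + r)) : R :=
  match fintype.split i with inl a => (m a)%:R | inr b => - (n b)%:R end.

(* Parametrization of the hyperplane by its first (k+r-1) coordinates p:
   h_i = p_i for i < k+r-1 and the last coordinate (= s_r) is solved from
   sum_i w_i h_i = 0. *)
(* weight of the last coordinate (s_r), i.e. -n_r when r > 0 *)
Definition wlast (k r : nat) (m : 'I_k -> nat) (n : 'I_r -> nat) : R :=
  \sum_(i < k + r | (i : nat) == (k + r).-1) weight m n i.

Definition hyp_embed (k r : nat) (m : 'I_k -> nat) (n : 'I_r -> nat)
  (p : seq R) : (k + r).-tuple R :=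
  let w := weight m n in
  let last := (k + r).-1 in
  let rest := \sum_(i < k + r | (i < last)%N) w i * nth 0 p i in
  [tuple (if (i < last)%N then nth 0 p i
          else - rest / wlast m n) | i < k + r].

(* Iterated Lebesgue integral over R^d (d nested one-dimensional Lebesgue
   integrals); by Fubini this is the integral w.r.t. Lebesgue measure on R^d
   for integrable g. *)
Fixpoint iter_lebesgue (d : nat) (g : seq R -> R) : R :=
  match d with
  | 0 => g [::]
  | d'.+1 => Rintegral (@lebesgue_measure R) setT
               (fun x => iter_lebesgue d' (fun p => g (x :: p)))
  end.

(* Integral over J^T w.r.t. the (k+r-1)-dimensional Lebesgue (surface)
   measure of the hyperplane: Lebesgue measure in the parameters times the
   area factor |w| / |w_last|. *)
Definition JT_integral (k r : nat) (m : 'I_k -> nat) (n : 'I_r -> nat)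
  (T : R) (f : (k + r).-tuple R -> R) : R :=
  let w := weight m n in
  (Num.sqrt (\sum_(i < k + r) w i ^+ 2) / `|wlast m n|) *
  iter_lebesgue (k + r).-1
    (fun p => f (hyp_embed m n p) * (\1_(inJT m n T) (hyp_embed m n p) : R)).

End Defs.

(* Register the filter x --> +oo on a real type as a filter_on, so that the
   Landau notation  f =o_(Rpinfty R) g  of MathComp-Analysis can be used. *)
Definition Rpinfty (R : realType) : filter_on R :=
  FilterType (pinfty_nbhs R) _.

(* Main.v *)
Require Import Defs.
From HB Require Import structures.
From mathcomp Require Import all_boot all_order all_algebra.
From mathcomp Require Import all_classical all_reals all_analysis.
From mathcomp Require Import measurable_realfun ring lra.
Import Order.TTheory GRing.Theory Num.Theory.
Import numFieldNormedType.Exports.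
Local Open Scope classical_set_scope.
Local Open Scope ring_scope.

(* Let d = k + r - 1. Points h of J^T with some coordinate below A log T, and
   the difference between J^T and J^N for N = floor T, lie in finitely many slabs
   of total volume O(T^(d-1) log T); as F is bounded they contribute only
   O(T^-1 log T) to the average. On the remaining part the correlations are at most
   C (T^(-delta A) + exp(-delta |h1 - h2|)), so for N <= N' <= 2^s the truncated
   integral over J^N' \ J^N has second moment O(vol (J^N' \ J^N)), once A is large.
   Splitting [0, N] dyadically (Rademacher-Menshov) bounds max_(N < 2^s) of the
   squared truncated integral by s times an energy of mean O(s 2^(s d)), and summing
   the energies with weights 2^(-s d) s^(-2-eps) gives the almost sure bound
   O(T^(d/2) (log T)^(3/2 + eps)), in particular O(T^(d-1) (log T)^(3/2 + eps))
   when d >= 2. *)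

Set Implicit Arguments.
Unset Strict Implicit.
Unset Printing Implicit Defensive.

(** * Parametric integrals on the line *)

(** The correlation bound gives no decay when a point is close to a face of the cone, because
    [floorv] enters the minimum; this forces the truncation. The threshold may depend on the dyadic
    scale [s] but not on the place reached in [0, 2^s], since otherwise a difference of two
    truncated integrals would not be an integral over J^N' \ J^N. So each [s] has its own path of
    truncated integrals, with threshold [layer s]. The square of the truncated integral carries (log
    T)^(3 + eps), so its root carries (log T)^(3/2 + eps/2); the spare (log T)^(-eps/2) turns O into
    o. The exceptional null set is found from integers [s] and [N] only; the passage to real T is
    deterministic. Integrals over the hyperplane are nested one-dimensional ones, with a
    conventional value where integrability fails. All integrands are therefore kept below a multiple
    of the indicator of a cube, and linearity, monotonicity and Fubini are proved for them by
    induction on the number of variables. *)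

Section OneVariable.
Context {R : realType}.
Local Notation leb := (@lebesgue_measure R).

(** No integrability is required: the integral is [fine] of the difference of the integrals of the
    positive and negative parts, each measurable by Tonelli. *)
Lemma measurable_Rintegral_param d (Z : measurableType d) d' (X : measurableType d')
    (mu : {sigma_finite_measure set X -> \bar R}) (g : Z * X -> R) :
  measurable_fun setT g ->
  measurable_fun setT (fun z => \int[mu]_x g (z, x)).
Proof.
move=> mg; pose h := EFin \o g.
have mh : measurable_fun [set: Z * X] h by exact/measurable_EFinP.
rewrite (_ : (fun _ => _) = fine \o (fun z =>
  (\int[mu]_x h^\+ (z, x)) - (\int[mu]_x h^\- (z, x)))%E); last first.
  by apply/funext => z; rewrite /Rintegral [X in fine X = _]integralE /=
    funepos.unlock funeneg.unlock.
apply: measurableT_comp => //; apply: emeasurable_funB.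
- apply: measurable_fun_fubini_tonelli_F => //; exact: measurable_funepos.
- apply: measurable_fun_fubini_tonelli_F => //; exact: measurable_funeneg.
Qed.

Lemma integrable_box1 (c L : R) (g : R -> R) : measurable_fun setT g ->
  (forall x, `|g x| <= c * \1_`[0, L] x) -> leb.-integrable setT (EFin \o g).
Proof.
move=> mg gb.
apply: (@le_integrable _ _ _ leb setT _ _ (EFin \o (fun x => c * \1_`[0, L] x))) => //.
- exact/measurable_EFinP.
- by move=> x _ /=; rewrite lee_fin (le_trans (gb x))// ler_norm.
- rewrite (_ : _ \o _ = fun x => (c%:E * (\1_`[0, L] x)%:E)%E); last first.
    by apply/funext => x /=; rewrite EFinM.
  by apply: integrableZl => //; exact: integrable_indic_itv.
Qed.

Lemma Rintegral_box1 (c L : R) : 0 <= L -> \int[leb]_x (c * \1_`[0, L] x) = c * L.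
Proof.
move=> L0; rewrite RintegralZl//; last exact: integrable_indic_itv.
congr (_ * _); rewrite /Rintegral integral_indic// setIT.
rewrite [X in fine X](lebesgue_measure_itv `[0, L])/= lte_fin; case: ltP => // [_|L0'].
  by rewrite -EFinB/= subr0.
by apply/esym/le_anti; rewrite L0 L0'.
Qed.

Lemma Rintegral_box1_bound (c L : R) (g : R -> R) : 0 <= L ->
  measurable_fun setT g ->
  (forall x, `|g x| <= c * \1_`[0, L] x) -> `|\int[leb]_x g x| <= c * L.
Proof.
move=> L0 mg gb; rewrite -Rintegral_box1//.
have ig := integrable_box1 mg gb.
apply: (le_trans (le_normr_Rintegral _ ig)) => //.
apply: le_Rintegral => //.
- apply: (@integrable_box1 c L) => //; first exact: measurableT_comp.
  by move=> x; rewrite normr_id.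
- apply: (@integrable_box1 `|c| L) => //.
    by apply: measurable_funM => //; exact: measurable_indic.
  by move=> x; rewrite normrM [X in _ * X]ger0_norm ?indicE.
Qed.
End OneVariable.

Section Fubini.
Context {R : realType}.
Local Notation leb := (@lebesgue_measure R).

Lemma Rintegral_Fubini d (Z : measurableType d)
    (mu : {sigma_finite_measure set Z -> \bar R}) (b : Z -> R) (L : R)
    (g : Z * R -> R) : 0 <= L ->
  measurable_fun setT g -> mu.-integrable setT (EFin \o b) ->
  (forall z x, `|g (z, x)| <= b z * \1_`[0, L] x) ->
  \int[mu]_z \int[leb]_x g (z, x) = \int[leb]_x \int[mu]_z g (z, x).
Proof.
move=> L0 mg ib gb.
have mgz z : measurable_fun setT (fun x => g (z, x)).
  exact: (measurableT_comp mg).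
have igz z : leb.-integrable setT (EFin \o (fun x => g (z, x))).
  exact: (integrable_box1 (mgz z) (gb z)).
have igx x : mu.-integrable setT (EFin \o (fun z => g (z, x))).
  apply: (le_integrable measurableT _ _ ib).
    apply/measurable_EFinP; exact: (measurableT_comp mg).
  move=> z _ /=; rewrite lee_fin (le_trans (gb z x))//.
  apply: (@le_trans _ _ (`|b z| * \1_`[0, L] x)).
    by rewrite ler_wpM2r// ler_norm.
  by rewrite -[leRHS]mulr1 ler_wpM2l// indicE; case: (_ \in _).
rewrite /Rintegral; congr fine.
(* Every section is integrable, not only almost every one, so [fine] cancels everywhere and Fubini
   for extended reals applies. *)
under eq_integral => z _ do rewrite fineK ?(integrable_fin_num _ (igz z))//.
under [RHS]eq_integral => x _ do rewrite fineK ?(integrable_fin_num _ (igx x))//.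
apply: (@Fubini _ _ _ _ R mu leb (EFin \o g)) => //.
apply/integrable12ltyP; first exact/measurable_EFinP.
have /integrableP[mLb Lb_lty] : mu.-integrable setT (fun z => L%:E * (b z)%:E)%E.
  exact: integrableZl.
apply: le_lt_trans Lb_lty.
have mag : measurable_fun [set: Z * R] (Num.norm \o g) by exact: measurableT_comp.
apply: ge0_le_integral => //.
- by move=> z _; exact: integral_ge0.
- apply: (@measurable_fun_fubini_tonelli_F _ _ _ _ _ leb (fun zx => `|(g zx)%:E|%E)) => //.
  by apply: measurableT_comp => //; exact/measurable_EFinP.
- exact: measurableT_comp.
- move=> z _.
  have mz : measurable_fun setT (fun x => `|g (z, x)|) by exact: measurableT_comp.
  have bz x : `| `|g (z, x)| | <= b z * \1_`[0, L] x by rewrite normr_id.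
  have iz : leb.-integrable setT (EFin \o (fun x => `|g (z, x)|)).
    exact: integrable_box1 bz.
  rewrite -EFinM -(fineK (integrable_fin_num measurableT iz)) lee_fin.
  apply: (le_trans (ler_norm _)); apply: (@le_trans _ _ (b z * L)).
    exact: Rintegral_box1_bound.
  by rewrite mulrC ler_norm.
Qed.
End Fubini.

(** * Iterated Lebesgue integrals *)

Section Iter.
Context {R : realType}.
Local Notation leb := (@lebesgue_measure R).
Local Notation iter := (@iter_lebesgue R).

Definition box (L : R) (p : seq R) : R := \prod_(x <- p) \1_`[0, L] x.

Lemma box_nil L : box L [::] = 1. Proof. by rewrite /box big_nil. Qed.

Lemma box_cons L x p : box L (x :: p) = \1_`[0, L] x * box L p.
Proof. by rewrite /box big_cons. Qed.

Lemma box_ge0 L p : 0 <= box L p.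
Proof. by rewrite /box prodr_ge0. Qed.

Lemma box_le1 L p : box L p <= 1.
Proof.
elim: p => [|x p IH]; first by rewrite box_nil.
by rewrite box_cons indicE; case: (_ \in _); rewrite ?mul1r ?mul0r.
Qed.

(* The domination by the box [0, L]^d makes every one-dimensional integral in an
   iterated integral absolutely convergent, for all (not almost all) values of the
   remaining variables. *)
Definition boxed dZ (Z : measurableType dZ) (d : nat) (b : Z -> R) (L : R)
    (G : Z -> seq R -> R) :=
  [/\ measurable_fun setT (fun zt : Z * d.-tuple R => G zt.1 zt.2),
      forall z, 0 <= b z &
      forall z p, size p = d -> `|G z p| <= b z * box L p].

(** The step of the inductions on [d]: the outermost variable of integration joins the parameter
    space. This is why [boxed] has parameters and a bound depending on them. *)
Lemma boxed_cons dZ (Z : measurableType dZ) d (b : Z -> R) (L : R) G : boxed d.+1 b L G ->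
  @boxed _ (Z * R)%type d (fun zx => b zx.1 * \1_`[0, L] zx.2) L
    (fun zx p => G zx.1 (zx.2 :: p)).
Proof.
move=> [mG b0 Gb]; split.
- pose f (w : (Z * R) * d.-tuple R) := (w.1.1, [the d.+1.-tuple R of w.1.2 :: w.2]).
  have mf : measurable_fun setT f.
    apply: measurable_fun_pair; first exact: measurableT_comp.
    by apply: measurable_cons => //; exact: measurableT_comp.
  exact: (measurableT_comp mG mf).
- by move=> z; rewrite mulr_ge0.
- by move=> z p sp; rewrite (le_trans (Gb _ _ _)) /= ?sp// box_cons mulrA.
Qed.

Lemma boxed_comp d1 d2 (Z1 : measurableType d1) (Z2 : measurableType d2) d
    (b : Z1 -> R) L G (f : Z2 -> Z1) : measurable_fun setT f -> boxed d b L G ->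
  boxed d (b \o f) L (fun z => G (f z)).
Proof.
move=> mf [mG b0 Gb]; split => [|z|z p sp] /=; [|exact: b0|exact: Gb].
apply: (measurableT_comp mG (g := fun zt : Z2 * d.-tuple R => (f zt.1, zt.2))).
by apply: measurable_fun_pair => //; exact: measurableT_comp.
Qed.

Lemma eq_iter d (G H : seq R -> R) :
  (forall p, size p = d -> G p = H p) -> iter d G = iter d H.
Proof.
elim: d G H => [|d IH] G H GH /=; first exact: GH.
by apply: eq_Rintegral => x _; apply: IH => p sp; rewrite GH//= sp.
Qed.

(** Both claims share one induction, since the bound at [d.+1] needs the inner integral to be
    measurable in its variable. *)
Lemma iter_measurable_bound dZ (Z : measurableType dZ) d (b : Z -> R) (L : R) G :
  0 <= L -> boxed d b L G ->
  measurable_fun setT (fun z => iter d (G z)) /\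
  forall z, `|iter d (G z)| <= b z * L ^+ d.
Proof.
move=> L0; elim: d dZ Z b G => [|d IH] dZ Z b G nG /=.
  case: nG => mG b0 Gb; split.
    apply: (measurableT_comp mG (g := fun z : Z => (z, [tuple] : 0.-tuple R))).
    by apply: measurable_fun_pair.
  by move=> z; rewrite (le_trans (Gb _ _ _))// box_nil expr0.
have [mI bI] := IH _ _ _ _ (boxed_cons nG).
split; first exact: (measurable_Rintegral_param leb mI).
move=> z; rewrite exprSr mulrA; apply: Rintegral_box1_bound => //.
  exact: measurable_fun_pair2 mI.
by move=> x; rewrite (le_trans (bI (z, x)))//= mulrAC.
Qed.

Lemma iter_measurable dZ (Z : measurableType dZ) d (b : Z -> R) (L : R) G :
  0 <= L -> boxed d b L G -> measurable_fun setT (fun z => iter d (G z)).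
Proof. by move=> L0 /(iter_measurable_bound L0)[]. Qed.

Lemma iter_bound dZ (Z : measurableType dZ) d (b : Z -> R) (L : R) G z :
  0 <= L -> boxed d b L G -> `|iter d (G z)| <= b z * L ^+ d.
Proof. by move=> L0 /(iter_measurable_bound L0)[]. Qed.

Lemma iter_slice dZ (Z : measurableType dZ) d (b : Z -> R) (L : R) G z : 0 <= L ->
  boxed d.+1 b L G ->
  leb.-integrable setT (EFin \o (fun x => iter d (fun p => G z (x :: p)))).
Proof.
move=> L0 nG; have [mI bI] := iter_measurable_bound L0 (boxed_cons nG).
apply: (@integrable_box1 _ (b z * L ^+ d) L).
  exact: measurable_fun_pair2 mI.
by move=> x; rewrite (le_trans (bI (z, x)))//= mulrAC.
Qed.

Lemma iter_linear dZ (Z : measurableType dZ) d (b c : Z -> R) (L : R) G H a z : 0 <= L ->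
  boxed d b L G -> boxed d c L H ->
  iter d (fun p => a * G z p + H z p) = a * iter d (G z) + iter d (H z).
Proof.
move=> L0; elim: d dZ Z b c G H z => [//|d IH] dZ Z b c G H z nG nH /=.
under eq_Rintegral => x _ do
  rewrite (IH _ _ _ _ _ _ (z, x) (boxed_cons nG) (boxed_cons nH)).
have iG := iter_slice z L0 nG; have iH := iter_slice z L0 nH.
rewrite RintegralD ?RintegralZl//.
rewrite (_ : _ \o _ = fun x => (a%:E * (iter d (fun p => G z (x :: p)))%:E)%E).
  exact: integrableZl.
by apply/funext => x /=; rewrite EFinM.
Qed.

Lemma iter_le dZ (Z : measurableType dZ) d (b c : Z -> R) (L : R) G H z : 0 <= L ->
  boxed d b L G -> boxed d c L H ->
  (forall p, size p = d -> G z p <= H z p) -> iter d (G z) <= iter d (H z).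
Proof.
move=> L0; elim: d dZ Z b c G H z => [|d IH] dZ Z b c G H z nG nH GH /=.
  exact: GH.
apply: le_Rintegral => //; [exact: iter_slice nG|exact: iter_slice nH|].
move=> x _; apply: (IH _ _ _ _ _ _ (z, x) (boxed_cons nG) (boxed_cons nH)).
by move=> p sp; apply: GH; rewrite /= sp.
Qed.

Lemma boxed_linear dZ (Z : measurableType dZ) d (b c : Z -> R) (L : R) G H a :
  boxed d b L G -> boxed d c L H ->
  boxed d (fun z => `|a| * b z + c z) L (fun z p => a * G z p + H z p).
Proof.
move=> [mG b0 Gb] [mH c0 Hc]; split => [|z|z p sp].
- by apply: measurable_funD => //; exact: measurable_funM.
- by rewrite addr_ge0// mulr_ge0.
- rewrite mulrDl (le_trans (ler_normD _ _))// lerD ?Hc// normrM -mulrA.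
  by rewrite ler_wpM2l// Gb.
Qed.

(** Used with [nu], to bring the expectation inside, and with Lebesgue measure, to make the
    outermost coordinate the innermost one. *)
Lemma iter_swap dZ (Z : measurableType dZ) (mu : {sigma_finite_measure set Z -> \bar R})
    d (b : Z -> R) (L : R) G : 0 <= L ->
  mu.-integrable setT (EFin \o b) -> boxed d b L G ->
  \int[mu]_z iter d (G z) = iter d (fun p => \int[mu]_z G z p).
Proof.
move=> L0; elim: d b G => [//|d IH] b G ib nG /=.
have [mI bI] := iter_measurable_bound L0 (boxed_cons nG).
have bZ (c : R) : mu.-integrable setT (EFin \o (fun z => b z * c)).
  rewrite (_ : _ \o _ = fun z => ((b z)%:E * c%:E)%E).
    exact: integrableZr.
  by apply/funext => x /=; rewrite EFinM.
rewrite (@Rintegral_Fubini _ _ _ mu (fun z => b z * L ^+ d) L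
  (fun zx => iter d (fun p => G zx.1 (zx.2 :: p))))//; last first.
  by move=> z x; rewrite (le_trans (bI (z, x)))//= mulrAC.
apply: eq_Rintegral => x _ /=.
have mx : measurable_fun setT (fun z : Z => (z, x)) by apply: measurable_fun_pair.
have nx : boxed d (fun z => b z * \1_`[0, L] x) L (fun z p => G z (x :: p)).
  exact: (boxed_comp mx (boxed_cons nG)).
exact: (IH _ _ (bZ _) nx).
Qed.

End Iter.

(* exp (- a |x - x0|) is at most f = 4 v / (1 + v)^2 with v = exp (a (x - x0)); f is
   smooth and has the bounded antiderivative F = - (4 / a) / (1 + v). *)
Section ExpIntegral.
Context {R : realType}.
Local Notation leb := (@lebesgue_measure R).
Variables (a x0 : R).
Hypothesis a0 : 0 < a.

Let v (x : R) : R := expR (a * (x - x0)).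
Let f (x : R) : R := 4 * v x / (1 + v x) / (1 + v x).
Let F (x : R) : R := - (4 / a) * (1 + v x)^-1.

Let v_gt0 (x : R) : 0 < 1 + v x.
Proof. by rewrite addr_gt0// expR_gt0. Qed.

Let dV (x : R) : is_derive x 1 (fun x : R => (1 + v x)^-1)
  (- (1 + v x) ^- 2 *: (a * v x)).
Proof.
have d1 : is_derive x 1 (fun x : R => 1 + v x) (a * v x).
  by apply: is_derive_eq; rewrite add0r mul1r subr0 /GRing.scale/= mulr1 mulrC.
by apply: (@is_deriveV R (fun x : R => 1 + v x) x _ 1 _ d1); rewrite gt_eqF.
Qed.

Let dF (x : R) : is_derive x 1 F (f x).
Proof.
have := dV x; rewrite /F => ?; apply: is_derive_eq.
rewrite /f /GRing.scale /=; field.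
by rewrite !gt_eqF// addr_gt0.
Qed.

Let cF : continuous F.
Proof.
by move=> x; apply/differentiable_continuous/derivable1_diffP; by have := dF x => ?; exact: ex_derive.
Qed.

Let cf : continuous f.
Proof.
move=> x; apply/differentiable_continuous/derivable1_diffP.
have := dV x; rewrite /f => ?; exact: ex_derive.
Qed.

Let f_le1 (x : R) : 0 <= f x <= 1.
Proof.
have v0 : 0 < v x := expR_gt0 _.
rewrite /f; apply/andP; split.
  by rewrite !divr_ge0// ?mulr_ge0// ltW.
rewrite ler_pdivrMr// ler_pdivrMr// -subr_ge0.
by rewrite (_ : _ - _ = (v x - 1) ^+ 2) ?sqr_ge0//; ring.
Qed.

(** For [v] at least 1 the claim reduces to (1 + v)^2 <= 4 v^2, for [v] at most 1 to (1 + v)^2 <=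
    4. *)
Let f_ge (x : R) : expR (- a * `|x - x0|) <= f x.
Proof.
rewrite /f.
have [xx|xx] := lerP 0 (x - x0).
- rewrite (ger0_norm xx); have -> : expR (- a * (x - x0)) = (v x)^-1 by rewrite mulNr expRN.
  have : 1 <= v x by rewrite -expR0 ler_expR mulr_ge0// ltW.
  move: (v x) => w w1.
  have w0 : 0 < w by lra.
  rewrite ler_pdivlMr ?addr_gt0// ler_pdivlMr ?addr_gt0// -(ler_pM2l w0).
  rewrite !mulrA mulfV ?gt_eqF//. nra.
- rewrite (ltr0_norm xx); have -> : expR (- a * - (x - x0)) = v x by rewrite mulrNN.
  have : v x <= 1 by rewrite -expR0 ler_expR pmulr_rle0// ltW.
  have : 0 < v x := expR_gt0 _.
  move: (v x) => w w0 w1.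
  rewrite ler_pdivlMr ?addr_gt0// ler_pdivlMr ?addr_gt0//.
  nra.
Qed.

Lemma Rintegral_exp_bound (L : R) : 0 <= L ->
  \int[leb]_x (\1_`[0, L] x * expR (- a * `|x - x0|)) <= 4 / a.
Proof.
move=> L0.
have mexp : measurable_fun setT (fun x : R => expR (- a * `|x - x0|)).
  apply: measurableT_comp => //; apply: measurable_funM => //.
  by apply: measurableT_comp => //; exact: measurable_funB.
have mf : measurable_fun setT f by exact: continuous_measurable_fun.
have mi : measurable_fun setT (\1_`[0, L] : R -> R) by exact: measurable_indic.
have i1 : leb.-integrable setT (EFin \o (fun x => \1_`[0, L] x * expR (- a * `|x - x0|))).
  apply: (@integrable_box1 _ 1 L); first exact: measurable_funM.
  move=> x; rewrite normrM mul1r ger0_norm// ler_piMr// ger0_norm ?expR_ge0//.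
  by rewrite -expR0 ler_expR mulNr oppr_le0 mulr_ge0// ltW.
have i2b x : `|f x * \1_`[0, L] x| <= 1 * \1_`[0, L] x.
  have /andP[f0 f1] := f_le1 x.
  by rewrite normrM (ger0_norm f0) ger0_norm// ler_wpM2r.
have m2 : measurable_fun setT (fun x => f x * \1_`[0, L] x) by exact: measurable_funM.
have i2 := integrable_box1 m2 i2b.
apply: (@le_trans _ _ (\int[leb]_x (f x * \1_`[0, L] x))).
  by apply: le_Rintegral => // x _; rewrite mulrC ler_wpM2r.
(* The fundamental theorem of calculus is applied on an interval of positive length, so L = 0 is
   treated apart. *)
move: L0; rewrite le_eqVlt => /predU1P[L0|L0].
  apply: (le_trans (ler_norm _)).
  by rewrite (le_trans (Rintegral_box1_bound _ m2 i2b)) -?L0// mulr0 divr_ge0// ltW.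
have -> : \int[leb]_x (f x * \1_`[0, L] x) = \int[leb]_(x in `[0, L]) f x.
  rewrite [RHS]Rintegral_mkcond; apply: eq_Rintegral => x _.
  by rewrite patchE indicE; case: (_ \in _); rewrite ?mulr1 ?mulr0.
rewrite /Rintegral (@continuous_FTC2 _ f F 0 L)//=; last 3 first.
- exact: continuous_subspaceT.
- split => [x _||]; first by have := dF x => ?; exact: ex_derive.
  + by apply: cvg_at_right_filter; exact: cF.
  + by apply: cvg_at_left_filter; exact: cF.
- by move=> x _; have := dF x => ?; rewrite derive1E; exact: derive_val.
have a4 : 0 <= 4 / a by rewrite divr_ge0// ltW.
rewrite /F !mulNr opprK addrC lerBlDr -[leLHS]addr0 lerD//.
  rewrite ler_piMr// invf_le1 // lerDl; exact: expR_ge0.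
by rewrite mulr_ge0// invr_ge0 ltW.
Qed.
End ExpIntegral.

Section IterIntegrals.
Context {R : realType}.
Local Notation leb := (@lebesgue_measure R).
Local Notation iter := (@iter_lebesgue R).

Lemma iter_ge0 d (G : seq R -> R) :
  (forall p, size p = d -> 0 <= G p) -> 0 <= iter d G.
Proof.
elim: d G => [|d IH] G G0 /=; first exact: G0.
by apply: Rintegral_ge0 => x _; apply: IH => p sp; apply: G0; rewrite /= sp.
Qed.

Lemma iter0 d : iter d (fun=> 0) = 0.
Proof.
elim: d => //= d IH; under eq_Rintegral => x _ do rewrite IH.
by rewrite Rintegral_cst// mul0r.
Qed.

Lemma iterZ dZ (Z : measurableType dZ) d (b : Z -> R) (L : R) G a z : 0 <= L ->
  boxed d b L G -> iter d (fun p => a * G z p) = a * iter d (G z).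
Proof.
move=> L0 nG; have n0 : boxed d (fun _ : Z => 0) L (fun _ _ => 0).
  by split => // z' p _; rewrite normr0 mul0r.
rewrite -[RHS]addr0 -(iter0 d) -(iter_linear a z L0 nG n0).
by apply: eq_iter => p _; rewrite addr0.
Qed.

Lemma iter_prod d (phi : nat -> R -> R) (c : R) :
  (forall i, leb.-integrable setT (EFin \o phi i)) ->
  iter d (fun p => c * \prod_(i < d) phi i (nth 0 p i)) =
  c * \prod_(i < d) \int[leb]_x phi i x.
Proof.
elim: d phi c => [|d IH] phi c iphi /=; first by rewrite !big_ord0.
under eq_Rintegral => x _.
  rewrite (_ : iter d _ = c * phi 0%N x * \prod_(i < d) \int[leb]_x phi i.+1 x).
    over.
  rewrite -(IH (fun i => phi i.+1))//; apply: eq_iter => p _.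
  by rewrite big_ord_recl mulrA.
rewrite RintegralZr//; last first.
  rewrite (_ : _ \o _ = fun x => (c%:E * (phi 0%N x)%:E)%E); last first.
    by apply/funext => x /=; rewrite EFinM.
  by apply: integrableZl => //; exact: iphi.
by rewrite RintegralZl ?big_ord_recl ?mulrA//; exact: iphi.
Qed.

Lemma box_prod d (L : R) p : size p = d -> box L p = \prod_(i < d) \1_`[0, L] (nth 0 p i).
Proof. by move=> <-; rewrite /box (big_nth 0) big_mkord. Qed.

(** The bound depends neither on [L] nor on [p]; this is what makes a second moment proportional to
    a volume instead of its square. *)
Lemma iter_exp_bound d (L a : R) (p : seq R) : 0 <= L -> 0 < a ->
  iter d (fun q => box L q * \prod_(i < d) expR (- a * `|nth 0 q i - nth 0 p i|))
    <= (4 / a) ^+ d.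
Proof.
move=> L0 a0.
pose phi i x := \1_`[0, L] x * expR (- a * `|x - nth 0 p i|).
rewrite (@eq_iter _ _ _ (fun q => 1 * \prod_(i < d) phi i (nth 0 q i))); last first.
  by move=> q sq; rewrite mul1r (box_prod _ sq) -big_split.
rewrite iter_prod; last first.
  move=> i; apply: (@integrable_box1 _ 1 L).
    apply: measurable_funM; first exact: measurable_indic.
    apply: measurableT_comp => //; apply: measurable_funM => //.
    by apply: measurableT_comp => //; exact: measurable_funB.
  move=> x; rewrite normrM mul1r ger0_norm// ler_piMr// ger0_norm ?expR_ge0//.
  by rewrite -expR0 ler_expR mulNr oppr_le0 mulr_ge0// ltW.
rewrite mul1r -[X in _ ^+ X](card_ord d) -prodr_const; apply: ler_prod => i _.
rewrite Rintegral_exp_bound// andbT.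
by apply: Rintegral_ge0 => x _; rewrite mulr_ge0// expR_ge0.
Qed.

End IterIntegrals.

(** * Volume of the part of a cube between two parallel hyperplanes *)

Section Slab.
Context {R : realType}.
Local Notation leb := (@lebesgue_measure R).
Local Notation iter := (@iter_lebesgue R).

Lemma measurable_natr_bool dZ (Z : measurableType dZ) (f : Z -> bool) :
  measurable_fun setT f -> measurable_fun setT (fun z => (f z)%:R : R).
Proof.
move=> mf; rewrite (_ : (fun _ => _) = fun z => if f z then 1 else 0 : R).
  exact: measurable_fun_ifT.
by apply/funext => z; case: (f z).
Qed.

Lemma measurable_nth dZ (Z : measurableType dZ) d i :
  measurable_fun setT (fun zt : Z * d.-tuple R => nth 0 zt.2 i).
Proof.
have [id|di] := ltnP i d.
  rewrite (_ : (fun _ => _) = (fun zt : Z * d.-tuple R => tnth zt.2 (Ordinal id))).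
    exact: (measurableT_comp (measurable_tnth (Ordinal id)) measurable_snd).
  by apply/funext => zt; rewrite (tnth_nth 0).
rewrite (_ : (fun _ => _) = cst 0) //.
by apply/funext => zt; rewrite nth_default// size_tuple.
Qed.

Lemma measurable_box dZ (Z : measurableType dZ) d (L : R) :
  measurable_fun setT (fun zt : Z * d.-tuple R => box L zt.2).
Proof.
rewrite (_ : (fun _ => _) = fun zt : Z * d.-tuple R =>
    \prod_(i < d) \1_`[0, L] (nth 0 zt.2 i)); last first.
  by apply/funext => zt; rewrite (box_prod (d := d))// size_tuple.
apply: measurable_prod => i _.
have mi : measurable_fun setT (\1_`[0, L] : R -> R) by exact: measurable_indic.
apply: (measurableT_comp mi); exact: measurable_nth.
Qed.

Lemma boxed_box dZ (Z : measurableType dZ) d (b : Z -> R) (L : R) (H : Z -> seq R -> R) :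
  measurable_fun setT (fun zt : Z * d.-tuple R => H zt.1 zt.2) ->
  (forall z, 0 <= b z) ->
  (forall z p, size p = d -> `|H z p| <= b z) ->
  boxed d b L (fun z p => box L p * H z p).
Proof.
move=> mH b0 Hb; split => // [|z p sp].
  by apply: measurable_funM => //; exact: measurable_box.
by rewrite normrM ger0_norm ?box_ge0// mulrC ler_wpM2r ?box_ge0 ?Hb.
Qed.

Lemma measurable_Rintegral_boxed dZ (Z : measurableType dZ)
    (mu : {sigma_finite_measure set Z -> \bar R}) d (b : Z -> R) (L : R) G :
  boxed d b L G ->
  measurable_fun setT (fun t : d.-tuple R => \int[mu]_z G z t).
Proof.
move=> [mG _ _].
apply: (@measurable_Rintegral_param _ _ _ _ _ mu (fun tz : d.-tuple R * Z => G tz.2 tz.1)).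
apply: (measurableT_comp mG (g := fun w : d.-tuple R * Z => (w.2, w.1))).
by apply: measurable_fun_pair.
Qed.

(** Coefficients are indexed by [nat], so that fixing the first coordinate only shifts [a] and moves
    the centre [g]. *)
Definition slab d (a : nat -> R) (g w : R) (p : seq R) : R :=
  (`|\sum_(i < d) a i * nth 0 p i - g| <= w)%R%:R.

Lemma measurable_slab dZ (Z : measurableType dZ) d (a : nat -> R) g w :
  measurable_fun setT (fun zt : Z * d.-tuple R => slab d a g w zt.2).
Proof.
apply: measurable_natr_bool; apply: measurable_fun_ler => //.
apply: measurableT_comp => //; apply: measurable_funB => //.
apply: measurable_sum => i; apply: measurable_funM => //; exact: measurable_nth.
Qed.

Lemma slab_ge0 d a g w p : 0 <= slab d a g w p.
Proof. by rewrite /slab ler0n. Qed.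

Lemma slab_le1 d a g w p : slab d a g w p <= 1.
Proof. by rewrite /slab lern1; case: (_ <= _). Qed.

Lemma slab_cons d a g w x p :
  slab d.+1 a g w (x :: p) = slab d (fun i => a i.+1) (g - a 0%N * x) w p.
Proof.
by rewrite /slab big_ord_recl /=; congr ((`|_| <= _)%R%:R); ring.
Qed.

Lemma boxed_slab dZ (Z : measurableType dZ) d a g w L :
  boxed d (fun _ : Z => 1) L (fun _ p => box L p * slab d a g w p).
Proof.
apply: boxed_box => //; first exact: measurable_slab.
by move=> z p _; rewrite ger0_norm ?slab_ge0// slab_le1.
Qed.

Lemma integrable_slab1 (a c g w L : R) : leb.-integrable setT
  (EFin \o (fun x => \1_`[0, L] x * (`|a * x + c - g| <= w)%R%:R)).
Proof.
apply: (@integrable_box1 _ 1 L).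
  apply: measurable_funM; first exact: measurable_indic.
  apply: measurable_natr_bool; apply: measurable_fun_ler => //.
  apply: measurableT_comp => //; apply: measurable_funB => //.
  by apply: measurable_funD => //; exact: measurable_funM.
by move=> x; rewrite normrM mul1r ger0_norm// ler_piMr// ger0_norm ?lern1 ?leq_b1.
Qed.

Lemma Rintegral_slab1 (a c g w L : R) : a != 0 -> 0 <= w -> 0 <= L ->
  \int[leb]_x (\1_`[0, L] x * (`|a * x + c - g| <= w)%R%:R) <= 2 * w / `|a|.
Proof.
move=> a0 w0 L0.
have aa : 0 < `|a| by rewrite normr_gt0.
pose x0 := (g - c) / a; pose r := w / `|a|.
have r0 : 0 <= r by rewrite divr_ge0.
have -> : 2 * w / `|a| = \int[leb]_x (\1_`[x0 - r, x0 + r] x : R).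
  rewrite /Rintegral integral_indic// setIT.
  rewrite [X in fine X](lebesgue_measure_itv `[x0 - r, x0 + r]) /= lte_fin.
  case: ltP => h; first by rewrite -EFinB /= /r; field; rewrite gt_eqF.
  have : r = 0 by apply/le_anti; rewrite r0 andbT; lra.
  by rewrite -mulrA -/r => ->; rewrite mulr0.
apply: le_Rintegral => //.
- exact: integrable_slab1.
- exact: integrable_indic_itv.
move=> x _; apply: (@le_trans _ _ ((`|a * x + c - g| <= w)%R%:R)).
  by rewrite ler_piMl// indicE; case: (_ \in _).
case: (lerP `|a * x + c - g| w) => [H|]; last by rewrite indicE.
rewrite indicE mem_set//= in_itv/= -ler_distl /r ler_pdivlMr// -normrM.
by rewrite (_ : (x - x0) * a = a * x + c - g)// /x0; field.
Qed.

(** Once the other variables are fixed, the variable of index [q] is confined to an interval of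
    length 2 w / |a q|, while each of the others ranges over [0, L]. *)
Lemma iter_slab d a g w L q : 0 <= w -> 0 <= L -> (q <= d)%N -> a q != 0 ->
  iter d.+1 (fun p => box L p * slab d.+1 a g w p) <= 2 * w / `|a q| * L ^+ d.
Proof.
move=> w0 L0; elim: d a g q => [|d IH] a g q qd aq.
  move: qd aq; rewrite leqn0 => /eqP-> a0.
  rewrite expr0 mulr1 /=; apply: le_trans (Rintegral_slab1 0 g a0 w0 L0).
  rewrite le_eqVlt; apply/orP; left; apply/eqP; apply: eq_Rintegral => x _.
  by rewrite slab_cons box_cons box_nil mulr1 /slab big_ord0; congr (_ * (_ <= _)%R%:R);
    congr (`|_|); ring.
pose G p := box L p * slab d.+2 a g w p.
have nG : boxed d.+1 (fun x : R => 1 * \1_`[0, L] x) L (fun x p => G (x :: p)).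
  have mx : measurable_fun setT (fun x : R => (tt, x)) by exact: measurable_fun_pair.
  exact: (boxed_comp mx (boxed_cons (boxed_slab unit d.+2 a g w L))).
(* If [q] is 0 the confined variable is the outermost one; its integral is moved inside and
   estimated first. *)
case: q qd aq => [_ a0|q qd aq].
  pose c := 2 * w / `|a 0%N|.
  have c0 : 0 <= c by rewrite divr_ge0// mulr_ge0.
  have Gle p : 0 <= \int[leb]_x G (x :: p) <= c * box L p.
    rewrite (_ : \int[leb]_x _ = \int[leb]_x (\1_`[0, L] x *
        (`|a 0%N * x + (\sum_(i < d.+1) a i.+1 * nth 0 p i) - g| <= w)%R%:R * box L p)).
      rewrite RintegralZr//; last exact: integrable_slab1.
      apply/andP; split; last by rewrite ler_wpM2r ?box_ge0// Rintegral_slab1.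
      by rewrite mulr_ge0 ?box_ge0//; apply: Rintegral_ge0 => x _; exact: mulr_ge0.
    apply: eq_Rintegral => x _; rewrite /G box_cons slab_cons /slab mulrAC.
    by congr (_ * (`|_| <= _)%R%:R * _); ring.
  have -> : iter d.+2 G = iter d.+1 (fun p => \int[leb]_x G (x :: p)).
    apply: (@iter_swap _ _ _ leb _ _ L _ _ _ nG) => //.
    rewrite (_ : _ \o _ = EFin \o \1_`[0, L]); first exact: integrable_indic_itv.
    by apply/funext => x /=; rewrite mul1r.
  have nI : boxed d.+1 (fun _ : unit => c) L (fun _ p => \int[leb]_x G (x :: p)).
    split => // [|_ p sp].
      apply: (measurableT_comp (measurable_Rintegral_boxed leb nG)) => //.
    by have /andP[I0 Ic] := Gle p; rewrite ger0_norm.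
  by rewrite (le_trans (ler_norm _))// (le_trans (iter_bound tt L0 nI)).
(* Otherwise the outermost variable is fixed in [0, L], and the induction hypothesis applies to the
   shifted coefficients. *)
apply: (le_trans (ler_norm _)); rewrite exprSr mulrA.
have mG := iter_measurable L0 nG.
apply: (Rintegral_box1_bound (g := fun x => iter d.+1 (fun p => G (x :: p)))) => // x.
rewrite ger0_norm; last first.
  by apply: (@iter_ge0 _ d.+1) => p _; rewrite mulr_ge0 ?box_ge0 ?slab_ge0.
case: (boolP (x \in `[0, L]%classic)) => xL.
  rewrite indicE xL mulr1; apply: le_trans (IH (fun i => a i.+1) (g - a 0%N * x) q qd aq).
  rewrite le_eqVlt; apply/orP; left; apply/eqP; apply: eq_iter => p _.
  by rewrite /G box_cons slab_cons indicE xL mul1r.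
rewrite indicE (negbTE xL) mulr0 (@eq_iter _ _ _ (fun=> 0)) ?iter0// => p _.
by rewrite /G box_cons indicE (negbTE xL) !mul0r.
Qed.

End Slab.

(** * Second moments *)

Section SecondMoment.
Context {R : realType}.
Local Notation iter := (@iter_lebesgue R).

Lemma boxed_mull dZ (Z : measurableType dZ) d (b c : Z -> R) (L : R) (f : Z -> R) G :
  measurable_fun setT f -> (forall z, `|f z| <= c z) -> boxed d b L G ->
  boxed d (fun z => c z * b z) L (fun z p => f z * G z p).
Proof.
move=> mf fc [mG b0 Gb].
have c0 z : 0 <= c z by rewrite (le_trans _ (fc z)).
split => [|z|z p sp].
- by apply: measurable_funM => //; exact: (measurableT_comp mf measurable_fst).
- exact: mulr_ge0.
- by rewrite normrM -mulrA ler_pM// Gb.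
Qed.

Lemma boxed_unit dZ (Z : measurableType dZ) d (b : Z -> R) (L : R) G z :
  boxed d b L G -> boxed d (fun _ : unit => b z) L (fun _ => G z).
Proof.
by move=> nG; apply: (boxed_comp (f := fun _ : unit => z) _ nG).
Qed.

Context dY (Y : measurableType dY) (nu : probability Y R).

Lemma integrable_prob_bounded (f : Y -> R) (M : R) : measurable_fun setT f ->
  (forall y, `|f y| <= M) -> nu.-integrable setT (EFin \o f).
Proof.
move=> mf fM; apply: (@le_integrable _ _ _ nu setT _ _ (EFin \o cst M)) => //.
- exact/measurable_EFinP.
- by move=> y _ /=; rewrite lee_fin (le_trans (fM y))// ler_norm.
- exact: finite_measure_integrable_cst.
Qed.

Lemma Rintegral_prob_bounded (f : Y -> R) (M : R) : measurable_fun setT f ->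
  (forall y, `|f y| <= M) -> `|\int[nu]_y f y| <= M.
Proof.
move=> mf fM; have fi := integrable_prob_bounded mf fM.
apply: (le_trans (le_normr_Rintegral measurableT fi)).
rewrite -[leRHS]mulr1 -[X in _ * X]/(fine 1%E) -(@probability_setT _ _ _ nu).
rewrite -Rintegral_cst//; apply: le_Rintegral => //.
- apply: (@integrable_prob_bounded _ M); first exact: measurableT_comp.
  by move=> y; rewrite normr_id.
- exact: finite_measure_integrable_cst.
Qed.

Variables (d : nat) (M L : R) (G : Y -> seq R -> R).
Hypotheses (L0 : 0 <= L) (nG : boxed d (fun=> M) L G).

Let corr (p q : seq R) : R := \int[nu]_y (G y p * G y q).

Let M0 : 0 <= M. Proof. by case: nG => _ /(_ point). Qed.

Let GM y (t : d.-tuple R) : `|G y t| <= M.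
Proof.
case: nG => _ _ Gb; rewrite (le_trans (Gb y _ (size_tuple t)))//.
by rewrite -[leRHS]mulr1 ler_wpM2l// box_le1.
Qed.

Let mGt (t : d.-tuple R) : measurable_fun setT (fun y => G y t).
Proof. by case: nG => mG _ _; exact: (measurable_fun_pair1 t mG). Qed.

Let nGt (t : d.-tuple R) : boxed d (fun=> M * M) L (fun y q => G y t * G y q).
Proof. exact: (boxed_mull (c := fun=> M) (mGt t) (fun y => GM y t) nG). Qed.

Lemma second_momentE : \int[nu]_y (iter d (G y)) ^+ 2 =
  iter d (fun p => iter d (fun q => \int[nu]_y (G y p * G y q))).
Proof.
have mI := iter_measurable L0 nG.
have nI : boxed d (fun=> M * L ^+ d * M) L (fun y p => iter d (G y) * G y p).
  apply: (boxed_mull (c := fun=> M * L ^+ d) mI) => // y.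
  exact: (iter_bound y L0 nG).
have iM c : nu.-integrable setT (EFin \o (fun=> c)).
  exact: finite_measure_integrable_cst.
under eq_Rintegral => y _ do rewrite expr2 -(iterZ _ _ L0 nG).
rewrite (iter_swap L0 (iM _) nI); apply: eq_iter => p sp.
(* Measurability in [boxed] is stated for tuples, so the sequence is replaced by a tuple of length
   [d]. *)
have -> : p = in_tuple p by []. 
move: (in_tuple p); rewrite sp => t.
rewrite -(iter_swap L0 (iM _) (nGt t)); apply: eq_Rintegral => y _.
by rewrite mulrC (iterZ _ _ L0 nG).
Qed.

(** The factor [box L t] is kept in the bound, so that the integral over the second point is again
    boxed as a function of the first. *)
Lemma boxed_corr :
  boxed d (fun t : d.-tuple R => M * M * box L t) L (fun t q => corr t q).
Proof.
split => [|t|t q sq]; last 2 first.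
- by rewrite mulr_ge0 ?box_ge0// mulr_ge0.
- case: nG => _ _ Gb; case: (nGt t) => mt _ _; rewrite /corr.
  have -> : q = in_tuple q by [].
  move: (in_tuple q); rewrite sq => s.
  apply: Rintegral_prob_bounded => [|y].
    exact: (measurable_fun_pair1 s mt).
  rewrite normrM (_ : _ * box L s = M * box L t * (M * box L s)); last by ring.
  by apply: ler_pM => //; apply: Gb; rewrite size_tuple.
apply: (@measurable_Rintegral_param _ _ _ _ _ nu
  (fun w : (d.-tuple R * d.-tuple R) * Y => G w.2 w.1.1 * G w.2 w.1.2)).
case: nG => mG _ _.
apply: measurable_funM.
- apply: (measurableT_comp mG (g := fun w : (d.-tuple R * d.-tuple R) * Y => (w.2, w.1.1))).
  by apply: measurable_fun_pair => //; exact: measurableT_comp.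
- apply: (measurableT_comp mG (g := fun w : (d.-tuple R * d.-tuple R) * Y => (w.2, w.1.2))).
  by apply: measurable_fun_pair => //; exact: measurableT_comp.
Qed.

(** For a fixed first point, the constant term integrates to [c1 * iter d B], and the exponential
    term, with [B q] enlarged to [box L q], to at most c2 (4 / a)^d. The integral over the first
    point then gives the single outer factor [iter d B]. *)
Lemma second_moment_le (B : seq R -> R) (c1 c2 a : R) :
  0 < a -> 0 <= c1 -> 0 <= c2 ->
  (forall p, 0 <= B p) -> boxed d (fun _ : unit => 1) L (fun=> B) ->
  (forall p q, size p = d -> size q = d -> \int[nu]_y (G y p * G y q) <=
    B p * B q * (c1 + c2 * \prod_(i < d) expR (- a * `|nth 0 q i - nth 0 p i|))) ->
  \int[nu]_y (iter d (G y)) ^+ 2 <= (c1 * iter d B + c2 * (4 / a) ^+ d) * iter d B.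
Proof.
move=> a0 c10 c20 B0 nB GB; rewrite second_momentE.
have V0 : 0 <= iter d B by apply: iter_ge0.
set c := _ + _.
have Bbox p : size p = d -> B p <= box L p.
  by move=> sp; case: nB => _ _ /(_ tt _ sp); rewrite mul1r; exact: le_trans (ler_norm _).
have inner (t : d.-tuple R) : iter d (corr t) <= c * B t.
  pose E (q : seq R) := box L q * \prod_(i < d) expR (- a * `|nth 0 q i - nth 0 t i|).
  have nE : boxed d (fun _ : unit => 1) L (fun=> E).
    apply: boxed_box => // [|_ p _].
      apply: measurable_prod => i _; apply: measurableT_comp => //.
      apply: measurable_funM => //; apply: measurableT_comp => //.
      by apply: measurable_funB => //; exact: measurable_nth.
    rewrite ger0_norm; last by apply: prodr_ge0 => i _; exact: expR_ge0.
    apply: prodr_ile1 => i _; rewrite expR_ge0/= -expR0 ler_expR mulNr oppr_le0.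
    by rewrite mulr_ge0// ltW.
  have cst_le (k : R) : measurable_fun setT (fun _ : unit => k) by [].
  have nE' := boxed_mull (c := fun=> `|B t * c2|) (cst_le (B t * c2)) (fun=> lexx _) nE.
  have E1 := iter_linear (B t * c1) tt L0 nB nE'.
  have n1 := boxed_linear (B t * c1) nB nE'.
  apply: (@le_trans _ _ (iter d (fun q => B t * c1 * B q + B t * c2 * E q))).
    apply: (iter_le (z := tt) L0 (boxed_unit t boxed_corr) n1) => q sq.
    apply: (le_trans (GB _ _ (size_tuple t) sq)).
    rewrite mulrDr lerD//; first by rewrite -!mulrA (mulrC (B q)).
    rewrite /E !mulrA; apply: ler_wpM2r.
      by apply: prodr_ge0 => i _; exact: expR_ge0.
    by rewrite -!mulrA (mulrC (B q)) !mulrA ler_wpM2l ?Bbox// mulr_ge0.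
  rewrite E1 (iterZ _ tt L0 nE) /c mulrDl lerD//.
    by rewrite (_ : _ * c1 * _ = c1 * iter d B * B t)//; ring.
  rewrite (_ : c2 * _ * _ = B t * c2 * (4 / a) ^+ d); last by ring.
  by rewrite ler_wpM2l// ?mulr_ge0//; exact: iter_exp_bound.
have c0 : 0 <= c by rewrite addr_ge0// mulr_ge0// exprn_ge0// divr_ge0// ltW.
rewrite -(iterZ c tt L0 nB).
have mcorr : measurable_fun setT (fun zt : unit * d.-tuple R => iter d (corr zt.2)).
  exact: (measurableT_comp (iter_measurable L0 boxed_corr) measurable_snd).
have nO : boxed d (fun _ : unit => M * M * L ^+ d) L (fun _ p => iter d (corr p)).
  split => // [_|_ p sp]; first by rewrite mulr_ge0 ?mulr_ge0 ?exprn_ge0.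
  have -> : p = in_tuple p by [].
  move: (in_tuple p); rewrite sp => t; rewrite mulrAC.
  exact: (iter_bound t L0 boxed_corr).
have mc : measurable_fun setT (fun _ : unit => c) by [].
have ncB := boxed_mull (c := fun=> c) mc (fun=> _) nB.
apply: (iter_le (z := tt) L0 nO (ncB _)) => [|p sp]; first by rewrite ger0_norm.
have -> : p = in_tuple p by [].
by move: (in_tuple p); rewrite sp => t; exact: inner.
Qed.

End SecondMoment.

(** * Dyadic chaining and almost sure bounds *)

Section Chaining.
Context {R : realType}.

Lemma sqr_sum_le (s : nat) (x : nat -> R) :
  (\sum_(i < s) x i) ^+ 2 <= s%:R * \sum_(i < s) x i ^+ 2.
Proof.
elim: s => [|s IH]; first by rewrite !big_ord0 expr0n mulr0.
rewrite !big_ord_recr/=; set S := \sum_(i < s) x i; set Q := \sum_(i < s) _.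
move: IH; rewrite -/S -/Q => IH.
have Q0 : 0 <= Q by apply: sumr_ge0 => i _; exact: sqr_ge0.
case: s @S @Q IH Q0 => [|s] S Q IH Q0.
  by rewrite /S /Q !big_ord0 !add0r mul1r.
have s0 : 0 < s.+1%:R :> R by rewrite ltr0n.
(* Multiplied by [s.+1], this cross-term bound follows from the induction hypothesis and (S - s.+1
   x)^2 >= 0. *)
suff : 2 * S * x s.+1 <= Q + s.+1%:R * x s.+1 ^+ 2.
  move=> h; rewrite -(natr1 s.+1) mulrDl mul1r; move: IH h; move: (s.+1%:R : R) => t; nra.
rewrite -(ler_pM2l s0); have := sqr_ge0 (S - s.+1%:R * x s.+1).
move: IH s0; move: (s.+1%:R : R) => t; nra.
Qed.

Definition dyadic_energy (s : nat) (a : nat -> R) : R :=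
  \sum_(i < s) \sum_(j < 2 ^ (s - i)) (a (j.+1 * 2 ^ i)%N - a (j * 2 ^ i)%N) ^+ 2.

(* Rounding N down to multiples of 1, 2, 4, ..., 2^s joins N to 0 by at most one
   dyadic increment per scale. *)
Lemma dyadic_chaining (s N : nat) (a : nat -> R) : (N < 2 ^ s)%N ->
  (a N - a 0%N) ^+ 2 <= s%:R * dyadic_energy s a.
Proof.
move=> Ns; pose Nf i := (N %/ 2 ^ i * 2 ^ i)%N.
have -> : a N - a 0%N = \sum_(i < s) (a (Nf i) - a (Nf i.+1)).
  rewrite -(big_mkord xpredT (fun i => a (Nf i) - a (Nf i.+1))).
  rewrite (@telescope_sumr_eq _ 0 s (fun i => - a (Nf i))) // => [|i _]; last by rewrite opprK addrC.
  (* The ends of the telescoping sum: [Nf 0] is [N], and [Nf s] is 0 because N < 2^s. *)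
  by rewrite opprK addrC /Nf divn_small// mul0n expn0 divn1 muln1.
apply: (le_trans (sqr_sum_le s (fun i => a (Nf i) - a (Nf i.+1)))).
apply: ler_wpM2l => //; apply: ler_sum => i _.
have Nfi : Nf i.+1 = ((N %/ 2 ^ i)./2 * 2 * 2 ^ i)%N.
  by rewrite /Nf expnS mulnA [X in (_ %/ X)%N]mulnC divnMA divn2.
(* The parity of N / 2^i decides: the two roundings coincide, or they differ by the increment of
   scale [i] whose index [j] is even. *)
have := odd_double_half (N %/ 2 ^ i); rewrite -muln2.
case: (odd _) => /= E; last first.
  have -> : Nf i = Nf i.+1 by rewrite Nfi /Nf -[in LHS]E add0n.
  by rewrite subrr expr0n /= sumr_ge0// => j _; exact: sqr_ge0.
have jlt : ((N %/ 2 ^ i)./2 * 2 < 2 ^ (s - i))%N.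
  rewrite (@leq_ltn_trans (N %/ 2 ^ i))//; first by rewrite -{2}E leq_addl.
  by rewrite ltn_divLR ?expn_gt0// -expnD subnK// ltnW.
rewrite (bigD1 (Ordinal jlt))//= -[leLHS]addr0 lerD//; last first.
  by apply: sumr_ge0 => j _; exact: sqr_ge0.
by rewrite Nfi /Nf -{1}E add1n.
Qed.

(** A discrete derivative of - x^(-e): it majorises the summable weights by differences, the form
    that [ae_bounded] asks for. It follows from ln (1 + t) <= t at t = - 1 / (x + 1) and from exp t
    >= 1 + t. *)
Lemma powRN_telescope (e x : R) : 0 < e -> 0 < x ->
  e * (x + 1) `^ (- (1 + e)) <= x `^ (- e) - (x + 1) `^ (- e).
Proof.
move=> e0 x0; have x1 : 0 < x + 1 by rewrite addr_gt0.
rewrite /powR !gt_eqF//.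
set a := ln (x + 1); set b := ln x.
have ba : b - a <= - (x + 1)^-1.
  rewrite /a /b -ln_div ?posrE// (_ : x / (x + 1) = 1 + - (x + 1)^-1).
    by apply: le_ln1Dx; rewrite ltrN2 invf_lt1// ltrDr.
  by field; rewrite gt_eqF.
have -> : expR (- (1 + e) * a) = (x + 1)^-1 * expR (- e * a).
  by rewrite mulNr mulrDl mul1r opprD expRD expRN lnK ?posrE// mulNr.
have -> : expR (- e * b) = expR (e * (a - b)) * expR (- e * a).
  by rewrite -expRD; congr expR; ring.
have := expR_ge1Dx (e * (a - b)); have := expR_gt0 (- e * a).
move: (expR (- e * a)) (expR (e * (a - b))) => p q p0 hq.
have : e * (x + 1)^-1 <= q - 1 by nra.
move: (x + 1)^-1 => w hw; nra.
Qed.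

End Chaining.

Section AlmostSureBound.
Context {R : realType} dY (Y : measurableType dY) (nu : probability Y R).

(** The whole series of the [X s] has integral at most [u 0] by telescoping; hence it is finite
    almost everywhere, and its sum bounds each term. *)
Lemma ae_bounded (X : nat -> Y -> R) (u : nat -> R) :
  (forall s, nu.-integrable setT (EFin \o X s)) -> (forall s y, 0 <= X s y) ->
  (forall s, 0 <= u s) -> (forall s, \int[nu]_y X s y <= u s - u s.+1) ->
  {ae nu, forall y, exists M, forall s, X s y <= M}.
Proof.
move=> iX X0 u0 Xu.
pose f y := (\sum_(0 <= s <oo) (X s y)%:E)%E.
have mX s : measurable_fun setT (EFin \o X s) by exact: (measurable_int nu (iX s)).
have f0 y : (0 <= f y)%E by apply: nneseries_ge0 => s _ _; rewrite lee_fin.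
have mf : measurable_fun setT f.
  apply: ge0_emeasurable_sum => [s y _ _|s _]; first by rewrite lee_fin.
  exact: mX.
have If : (\int[nu]_y f y <= (u 0%N)%:E)%E.
  rewrite integral_nneseries//; last by move=> s y _; rewrite lee_fin.
  apply: lime_le.
    by apply: is_cvg_nneseries => s _ _; apply: integral_ge0 => y _; rewrite lee_fin.
  apply: nearW => n; apply: (@le_trans _ _ (\sum_(0 <= s < n) (u s - u s.+1)%:E)%E).
    apply: lee_sum => s _; rewrite -(fineK (integrable_fin_num measurableT (iX s))).
    by rewrite lee_fin; exact: Xu.
  rewrite sumEFin lee_fin (@telescope_sumr_eq _ 0 n (fun s => - u s))//.
    by rewrite opprK addrC gerBl.
  by move=> s _; rewrite opprK addrC.
have fi : nu.-integrable setT f.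
  apply/integrableP; split => //; under eq_integral => y _ do rewrite gee0_abs//.
  exact: le_lt_trans If (ltry _).
have := integrable_ae measurableT fi; apply: filterS => y /(_ I) fy.
exists (fine (f y)) => s; rewrite -lee_fin fineK//.
apply: (@le_trans _ _ (\sum_(0 <= i < s.+1) (X i y)%:E)%E).
  by rewrite big_nat_recr//= leeDr// sume_ge0// => i _; rewrite lee_fin.
by apply: nneseries_lim_ge => i _ _; rewrite lee_fin.
Qed.
End AlmostSureBound.

(** * The cone in coordinates *)

Section Geometry.
Context {R : realType} (k r : nat) (m : 'I_k -> nat) (n : 'I_r -> nat).
Hypotheses (k0 : (0 < k)%N) (r0 : (0 < r)%N).
Hypotheses (m0 : forall i, (0 < m i)%N) (n0 : forall j, (0 < n j)%N).
Local Notation iter := (@iter_lebesgue R).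
Local Notation d := (k + r).-1.
Local Notation emb := (@hyp_embed R k r m n).
Local Notation w := (@weight R k r m n).

Let krE : (k + r = d.+1)%N. Proof. by rewrite prednK// addn_gt0 k0. Qed.

Let d_gt0 : (0 < d)%N.
Proof. by case: k r k0 r0 => // k' [|r']// _ _; rewrite addSn addnS. Qed.

Lemma wlast_neq0 : @wlast R k r m n != 0.
Proof.
have dlt : (d < k + r)%N by rewrite krE.
rewrite /wlast (bigD1 (Ordinal dlt))//= big1 ?addr0; last first.
  by move=> i /andP[/eqP id /eqP]; case; apply: val_inj.
rewrite /weight; case: splitP => [j /= dj|j /= dj].
  by have := ltn_ord j; rewrite -dj; case: (r) r0 => // r' _; rewrite addnS /= -ltn_subRL subnn.
by rewrite oppr_eq0 pnatr_eq0 -lt0n.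
Qed.

Lemma weight_neq0 i : w i != 0.
Proof.
by rewrite /weight; case: splitP => j _; rewrite ?oppr_eq0 pnatr_eq0 -lt0n.
Qed.

(** The matrix of the linear map [hyp_embed], with columns indexed by [nat] to fit [slab]; the
    default 0 is not reached for columns below [d]. *)
Definition embed_coef (i : 'I_(k + r)) (j : nat) : R :=
  if (i < d)%N then (j == i)%:R
  else if insub j is Some j' then - w j' / wlast R m n else 0.

Lemma hyp_embed_linear (p : seq R) i :
  tnth (emb p) i = \sum_(j < d) embed_coef i j * nth 0 p j.
Proof.
rewrite tnth_mktuple /embed_coef; case: ifPn => id.
  rewrite (bigD1 (Ordinal id))//= eqxx mul1r big1 ?addr0// => j ji.
  by rewrite (_ : (j == i :> nat) = false) ?mul0r//; apply: contra_neqF ji => /eqP ji; apply: val_inj.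
have dkr : (d <= k + r)%N by rewrite leq_pred.
rewrite (big_ord_narrow dkr) -sumrN mulr_suml; apply: eq_bigr => j _.
have jlt : (j < k + r)%N by rewrite (leq_trans (ltn_ord j)).
rewrite insubT /= mulrAC !mulNr; congr (- (w _ * _ / _)).
exact: val_inj.
Qed.

(** Each coordinate of the hyperplane, the solved one included, is a non-zero linear form in the
    parameters; so a bound on any coordinate cuts out a thin slab. For the solved coordinate the
    column 0 serves, and [d] is positive. *)
Lemma embed_coef_neq0 i : exists2 q, (q < d)%N & embed_coef i q != 0.
Proof.
have [id|di] := ltnP i d.
  by exists i => //; rewrite /embed_coef id eqxx oner_eq0.
have kr0 : (0 < k + r)%N by rewrite addn_gt0 k0.
exists 0%N; first exact: d_gt0.
rewrite /embed_coef ltnNge di /= (insubT (fun x => x < k + r)%N kr0).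
by rewrite mulf_neq0 ?invr_eq0 ?wlast_neq0// oppr_eq0 weight_neq0.
Qed.

Lemma measurable_hyp_embed dZ (Z : measurableType dZ) :
  measurable_fun setT (fun zt : Z * d.-tuple R => emb zt.2).
Proof.
apply/measurable_fun_tnthP => i.
rewrite (_ : _ \o _ = fun zt : Z * d.-tuple R => \sum_(j < d) embed_coef i j * nth 0 zt.2 j).
  by apply: measurable_sum => j; apply: measurable_funM => //; exact: measurable_nth.
by apply/funext => zt /=; rewrite hyp_embed_linear.
Qed.

Lemma iter_coord_slab : exists2 kappa : R, 0 <= kappa & forall i (g v L : R), 0 <= v -> 0 <= L ->
  iter d (fun p => box L p * (`|tnth (emb p) i - g| <= v)%R%:R) <= kappa * v * L ^+ d.-1.
Proof.
pose q i := projT1 (cid2 (embed_coef_neq0 i)).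
have qd i : (q i < d)%N by rewrite /q; case: cid2.
have q0 i : embed_coef i (q i) != 0 by rewrite /q; case: cid2.
(* The sum over all coordinates makes the constant independent of [i]. *)
exists (\sum_i 2 / `|embed_coef i (q i)|).
  by apply: sumr_ge0 => i _; rewrite divr_ge0.
move=> i g v L v0 L0.
apply: (@le_trans _ _ (2 * v / `|embed_coef i (q i)| * L ^+ d.-1)).
  have dE : d = d.-1.+1 by rewrite prednK.
  rewrite (@eq_iter _ _ _ (fun p => box L p * slab d (embed_coef i) g v p)); last first.
    by move=> p sp; rewrite hyp_embed_linear.
  have := @iter_slab R d.-1 (embed_coef i) g v L (q i) v0 L0.
  by rewrite -dE => -> //; rewrite -ltnS -dE.
rewrite ler_wpM2r ?exprn_ge0// mulrAC ler_wpM2r//.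
rewrite (bigD1 i)//= lerDl; by apply: sumr_ge0 => j _; rewrite divr_ge0.
Qed.

Definition indJT (T : R) (p : seq R) : R := \1_(inJT m n T) (emb p).

Lemma indJTP T p : reflect (inJT m n T (emb p)) (emb p \in (inJT m n T : set (_.-tuple R))).
Proof. by apply: (iffP idP); rewrite in_setE. Qed.

Lemma indJT_ge0 T p : 0 <= indJT T p.
Proof. by rewrite /indJT indicE. Qed.

Lemma indJT_le1 T p : indJT T p <= 1.
Proof. by rewrite /indJT indicE; case: (_ \in _). Qed.

Lemma le_indJT T T' p : T <= T' -> indJT T p <= indJT T' p.
Proof.
move=> TT'; rewrite /indJT !indicE; case: (indJTP T) => [[h1 h2]|_] //.
rewrite mem_set//; split => // j; exact: le_trans (h2 j) TT'.
Qed.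

Definition nsum : R := \sum_(j < r) (n j)%:R.

Lemma nsum_ge1 : 1 <= nsum.
Proof.
rewrite /nsum (bigD1 (Ordinal r0))//= -[leLHS]addr0 lerD ?ler1n//.
by apply: sumr_ge0.
Qed.

(** Since m_j >= 1, a coordinate t_j is at most the sum of the m_i t_i, which equals that of the n_l
    s_l and so is at most [nsum * T]. A coordinate s_j is at most [T], and [nsum] is at least 1. *)
Lemma inJT_bound T (h : (k + r).-tuple R) : inJT m n T h -> forall i, tnth h i <= nsum * T.
Proof.
move=> [[h0 hE] hT] i.
have T0 : 0 <= T by rewrite (le_trans _ (hT (Ordinal r0)))// h0.
rewrite -(splitK i); case: (fintype.split i) => j /=; last first.
  by apply: (le_trans (hT j)); rewrite ler_peMl// nsum_ge1.
apply: (@le_trans _ _ (\sum_(i < k) (m i)%:R * tcoord h i)).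
  rewrite (bigD1 j)//= -[leLHS]addr0 lerD//.
    by rewrite ler_peMl ?h0// ler1n.
  by apply: sumr_ge0 => l _; rewrite mulr_ge0// h0.
by rewrite hE /nsum mulr_suml; apply: ler_sum => l _; rewrite ler_wpM2l.
Qed.

Lemma indJT_le_box T L p : nsum * T <= L -> size p = d -> indJT T p <= box L p.
Proof.
move=> TL sp; rewrite /indJT indicE; case: indJTP => [hJ|_]; last exact: box_ge0.
rewrite (box_prod L sp) big1// => i _.
have ilt : (i < k + r)%N by rewrite (leq_trans (ltn_ord i))// leq_pred.
have iE : nth 0 p i = tnth (emb p) (Ordinal ilt) by rewrite tnth_mktuple /= ltn_ord.
rewrite indicE mem_set//= in_itv /= iE; case: (hJ) => -[h0 _] _.
by rewrite h0 (le_trans (inJT_bound hJ _)).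
Qed.

Lemma measurable_inJT T : measurable [set h : (k + r).-tuple R | inJT m n T h].
Proof.
have mt i : measurable_fun setT (fun h : (k + r).-tuple R => tnth h i).
  exact: measurable_tnth.
have -> : [set h : (k + r).-tuple R | inJT m n T h] =
    (\bigcap_(i in [set: 'I_(k + r)]) [set h | 0 <= tnth h i]) `&`
    [set h | \sum_(i < k) (m i)%:R * tcoord h i = \sum_(j < r) (n j)%:R * scoord h j] `&`
    (\bigcap_(j in [set: 'I_r]) [set h | scoord h j <= T]).
  apply/seteqP; split => h /=.
    by move=> [[h0 hE] hT]; split; [split => //|] => i _; [exact: h0|exact: hT].
  by move=> [[h0 hE] hT]; split; [split => //|] => i; [exact: h0|exact: hT].
apply: measurableI; first apply: measurableI.
- apply: fin_bigcap_measurable => // i _; rewrite -[X in measurable X]setTI.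
  exact: measurable_fun_le.
- pose f (h : (k + r).-tuple R) := \sum_(i < k) (m i)%:R * tcoord h i.
  pose g (h : (k + r).-tuple R) := \sum_(j < r) (n j)%:R * scoord h j.
  have mf : measurable_fun setT f.
    by apply: measurable_sum => i; apply: measurable_funM => //; exact: mt.
  have mg : measurable_fun setT g.
    by apply: measurable_sum => i; apply: measurable_funM => //; exact: mt.
  rewrite (_ : [set _ | _] = [set h | f h <= g h] `&` [set h | g h <= f h]).
    by apply: measurableI; rewrite -[X in measurable X]setTI; exact: measurable_fun_le.
  by apply/seteqP; split => h /=; [rewrite /f /g => ->|
    move=> [fg gf]; apply/le_anti; rewrite -/(f h) -/(g h) fg gf].
- apply: fin_bigcap_measurable => // i _; rewrite -[X in measurable X]setTI.
  by apply: measurable_fun_le => //; exact: mt.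
Qed.

Lemma measurable_indJT dZ (Z : measurableType dZ) T :
  measurable_fun setT (fun zt : Z * d.-tuple R => indJT T zt.2).
Proof.
have mi : measurable_fun setT (\1_(inJT m n T) : (k + r).-tuple R -> R).
  exact: measurable_indic (measurable_inJT T).
exact: (measurableT_comp mi (@measurable_hyp_embed _ Z)).
Qed.

(** The truncation away from the faces of the cone. It does not involve T, so increments in T of
    truncated integrals are integrals over the difference of two sets J^T. *)
Definition inner (A : R) (p : seq R) : R := [forall i, A <= tnth (emb p) i]%:R.

Lemma measurable_inner dZ (Z : measurableType dZ) A :
  measurable_fun setT (fun zt : Z * d.-tuple R => inner A zt.2).
Proof.
rewrite (_ : (fun _ => _) = \1_[set zt : Z * d.-tuple R | forall i, A <= tnth (emb zt.2) i]).
  apply: measurable_indic.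
  rewrite (_ : [set _ | _] = \bigcap_(i in [set: 'I_(k + r)]) [set zt : Z * d.-tuple R | A <= tnth (emb zt.2) i]).
    apply: fin_bigcap_measurable => // i _; rewrite -[X in measurable X]setTI.
    apply: measurable_fun_le => //.
    exact: (measurableT_comp (measurable_tnth i) (@measurable_hyp_embed _ Z)).
  by apply/seteqP; split => h /= H i; [move=> _|]; exact: H.
apply/funext => zt; rewrite /inner indicE; congr (nat_of_bool _)%:R.
by apply/forallP/idP; rewrite in_setE.
Qed.

End Geometry.

Section FloorSup.
Context {R : realType}.

Lemma floorv_ge (d : nat) (h : d.+1.-tuple R) (A : R) :
  (forall i, A <= tnth h i) -> A <= floorv h.
Proof.
move=> hA; rewrite /floorv.
have sA x : x \in [seq `|x| | x <- tval h] -> A <= x.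
  by move=> /mapP[y /tnthP[i ->] ->]; rewrite (le_trans (hA i))// ler_norm.
(* The fold in [floorv] starts from the head, which for a non-empty tuple is one of the entries. *)
have : A <= head 0 [seq `|x| | x <- tval h].
  by apply: sA; case: h {hA} => -[|x t] //= _; rewrite mem_head.
move: (head _ _) => x0 x0A; elim: [seq _ | _ <- _] sA => [//|x t IH] sA /=.
rewrite le_min sA ?mem_head//= IH// => y yt; apply: sA.
by rewrite inE yt orbT.
Qed.

Lemma le_supdist (d : nat) (h1 h2 : d.-tuple R) i :
  `|tnth h1 i - tnth h2 i| <= supdist h1 h2.
Proof.
exact: (le_bigmax_cond (P := xpredT) 0 (fun i => `|tnth h1 i - tnth h2 i|)).
Qed.

End FloorSup.

(** * Truncated integrals *)

Section Increments.
Context {R : realType} (k r : nat) (m : 'I_k -> nat) (n : 'I_r -> nat).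
Hypotheses (k0 : (0 < k)%N) (r0 : (0 < r)%N).
Hypotheses (m0 : forall i, (0 < m i)%N) (n0 : forall j, (0 < n j)%N).
Local Notation iter := (@iter_lebesgue R).
Local Notation d := (k + r).-1.
Local Notation emb := (@hyp_embed R k r m n).
Local Notation indJT := (@indJT R k r m n).
Local Notation inner := (@inner R k r m n).
Local Notation nsum := (@nsum R r n).
Context dY (Y : measurableType dY) (nu : probability Y R).
Variables (F : Y * (k + r).-tuple R -> R) (M delta C : R).
Hypotheses (mF : measurable_fun setT F) (FM : forall z, `|F z| <= M).
Hypotheses (delta0 : 0 < delta) (C0 : 0 < C).
Hypothesis mixing : forall h1 h2 : (k + r).-tuple R, inRcone m n h1 -> inRcone m n h2 ->
  `| \int[nu]_x (F (x, h1) * F (x, h2)) | <= C * expR (- delta *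
     Num.min (Num.min (floorv h1) (floorv h2)) (supdist h1 h2)).

Let d_gt0 : (0 < d)%N.
Proof. by case: k r k0 r0 => // k' [|r']// _ _; rewrite addSn addnS. Qed.

(** The rate left to each parameter when the decay in the sup distance is shared equally among [d]
    coordinates. *)
Let a := delta / d%:R.
Let a0 : 0 < a. Proof. by rewrite divr_gt0// ltr0n. Qed.

Lemma inner_ge0 A p : 0 <= inner A p. Proof. exact: ler0n. Qed.

Lemma inner_le1 A p : inner A p <= 1.
Proof. by rewrite /inner; case: [forall _, _]. Qed.

Lemma boxed_cutoff A L (B : seq R -> R) : boxed d (fun _ : unit => 1) L (fun=> B) ->
  boxed d (fun _ : Y => M) L (fun y p => F (y, emb p) * (inner A p * B p)).
Proof.
case=> mB _ Bb; split => [|y|y p sp].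
- apply: measurable_funM.
    apply: (measurableT_comp mF (g := fun zt : Y * d.-tuple R => (zt.1, emb zt.2))).
    by apply: measurable_fun_pair => //; exact: measurable_hyp_embed.
  apply: measurable_funM; first exact: measurable_inner.
  apply: (measurableT_comp mB (g := fun zt : Y * d.-tuple R => (tt, zt.2))).
  by apply: measurable_fun_pair.
- exact: le_trans (FM (y, emb [::])).
- have := Bb tt p sp; rewrite mul1r => Bp.
  rewrite normrM ler_pM//.
  rewrite normrM (ger0_norm (inner_ge0 _ _)) (le_trans _ Bp)//.
  by rewrite ler_piMl// inner_le1.
Qed.

(** The exponential at a minimum is at most the sum of the exponentials at its arguments. Both
    floors are at least [A], and the sup distance is at least the mean of the distances of the [d]
    parameters, which turns its exponential into a product. *)
Let mixing_split A p q : inRcone m n (emb p) -> inRcone m n (emb q) ->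
  (forall i, A <= tnth (emb p) i) -> (forall i, A <= tnth (emb q) i) ->
  `| \int[nu]_x (F (x, emb p) * F (x, emb q)) | <=
  C * expR (- delta * A) + C * \prod_(i < d) expR (- a * `|nth 0 q i - nth 0 p i|).
Proof.
move=> hp hq Ap Aq; apply: (le_trans (mixing hp hq)).
rewrite -mulrDr ler_pM2l//.
have krE : (k + r = d.+1)%N by rewrite prednK// addn_gt0 k0.
have fl (h : (k + r).-tuple R) : (forall i, A <= tnth h i) -> A <= floorv h.
  by move: h; rewrite krE => h; exact: floorv_ge.
have [h|h] := leP (Num.min (floorv (emb p)) (floorv (emb q))) (supdist (emb p) (emb q)).
  rewrite -[leLHS]addr0 lerD//; last by apply: prodr_ge0 => i _; exact: expR_ge0.
  rewrite ler_expR !mulNr lerN2 ler_pM2l// le_min !fl//.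
rewrite -[leLHS]add0r lerD ?expR_ge0//.
rewrite -expR_sum ler_expR -mulr_sumr !mulNr lerN2 /a.
rewrite mulrAC ler_pdivrMr ?ltr0n// -mulrA ler_pM2l//.
rewrite mulr_natr -[X in _ *+ X](card_ord d) -sumr_const; apply: ler_sum => i _.
have ilt : (i < k + r)%N by rewrite (leq_trans (ltn_ord i))// leq_pred.
have E t : nth 0 t i = tnth (emb t) (Ordinal ilt) by rewrite tnth_mktuple /= ltn_ord.
by rewrite distrC !E; exact: le_supdist.
Qed.

Let mFe (h : (k + r).-tuple R) : measurable_fun setT (fun y => F (y, h)).
Proof. exact: measurable_fun_pair1 mF. Qed.

Lemma cutoff_second_moment A L (B : seq R -> R) : 0 <= L ->
  boxed d (fun _ : unit => 1) L (fun=> B) -> (forall p, 0 <= B p) ->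
  (forall p, B p != 0 -> inRcone m n (emb p)) ->
  \int[nu]_y (iter d (fun p => F (y, emb p) * (inner A p * B p))) ^+ 2 <=
  (C * expR (- delta * A) * iter d B + C * (4 / a) ^+ d) * iter d B.
Proof.
move=> L0 nB B0 BR.
apply: (second_moment_le L0 (boxed_cutoff A nB) a0 _ _ B0 nB).
- by rewrite mulr_ge0 ?expR_ge0// ltW.
- exact: ltW.
move=> p q sp sq; set rhs := (X in _ <= X).
have rhs0 : 0 <= rhs.
  rewrite !mulr_ge0// addr_ge0// ?mulr_ge0 ?expR_ge0 ?(ltW C0)//.
  by apply: prodr_ge0 => i _; exact: expR_ge0.
pose I t := inner A t * B t.
have -> : \int[nu]_y (F (y, emb p) * (inner A p * B p) * (F (y, emb q) * (inner A q * B q)))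
    = I p * I q * \int[nu]_y (F (y, emb p) * F (y, emb q)).
  rewrite -RintegralZl//; first by apply: eq_Rintegral => y _; rewrite /I; ring.
  apply: (@integrable_prob_bounded _ _ _ _ _ (M * M)); first exact: measurable_funM.
  by move=> y; rewrite normrM ler_pM.
(* A vanishing weight makes the left side 0; otherwise both points lie in the cone with all
   coordinates at least [A]. *)
have [Ip0|Ip0] := eqVneq (I p) 0; first by rewrite Ip0 !mul0r.
have [Iq0|Iq0] := eqVneq (I q) 0; first by rewrite Iq0 mulr0 mul0r.
have split_I t : I t != 0 -> [/\ B t != 0, I t = B t & forall i, A <= tnth (emb t) i].
  rewrite /I /inner mulf_eq0 negb_or => /andP[+ Bt].
  by case: forallP => [hA _|]; [rewrite mul1r|rewrite eqxx].
have [Bp -> Ap] := split_I _ Ip0; have [Bq -> Aq] := split_I _ Iq0.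
rewrite ler_wpM2l ?mulr_ge0//; apply: (le_trans (ler_norm _)).
exact: mixing_split (BR _ Bp) (BR _ Bq) Ap Aq.
Qed.

Lemma boxed_indJT T L : nsum * T <= L -> boxed d (fun _ : unit => 1) L (fun=> indJT T).
Proof.
move=> TL; split => [||_ p sp] //; first exact: measurable_indJT.
by rewrite mul1r ger0_norm ?indJT_ge0//; exact: indJT_le_box.
Qed.

Lemma boxed_indJTB T T' L : T <= T' -> nsum * T' <= L ->
  boxed d (fun _ : unit => 1) L (fun=> fun p => indJT T' p - indJT T p).
Proof.
move=> TT' TL; split => [||_ p sp] //.
  by apply: measurable_funB; exact: measurable_indJT.
rewrite mul1r ger0_norm ?subr_ge0 ?le_indJT//.
by rewrite (le_trans _ (indJT_le_box r0 m0 n0 TL sp))// lerBlDr lerDl indJT_ge0.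
Qed.

Let nsum0 : 0 <= nsum. Proof. exact: le_trans ler01 (nsum_ge1 r0 n0). Qed.

Lemma iter_indJT_le T : 0 <= T -> 0 <= iter d (indJT T) <= (nsum * T) ^+ d.
Proof.
move=> T0; rewrite iter_ge0 /=; last by move=> p _; exact: indJT_ge0.
have L0 : 0 <= nsum * T by exact: mulr_ge0.
have := iter_bound tt L0 (boxed_indJT (lexx (nsum * T))).
by rewrite mul1r; apply: le_trans; exact: ler_norm.
Qed.

Definition cutoff_integral A y T : R :=
  iter d (fun p => F (y, emb p) * (inner A p * indJT T p)).

Lemma cutoff_integralB A y T T' : T <= T' -> 0 <= T' ->
  cutoff_integral A y T' - cutoff_integral A y T =
  iter d (fun p => F (y, emb p) * (inner A p * (indJT T' p - indJT T p))).
Proof.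
move=> TT' T0; have L0 : 0 <= nsum * T' by exact: mulr_ge0.
have n1 := boxed_cutoff A (boxed_indJT (ler_wpM2l nsum0 TT')).
have n2 := boxed_cutoff A (boxed_indJTB TT' (lexx (nsum * T'))).
have := iter_linear 1 y L0 n1 n2; rewrite mul1r => E.
rewrite /cutoff_integral; apply/eqP; rewrite subr_eq addrC -E; apply/eqP.
by apply: eq_iter => p _; ring.
Qed.

Lemma measurable_cutoff_integral A T : 0 <= T ->
  measurable_fun setT (fun y => cutoff_integral A y T).
Proof.
move=> T0; have L0 : 0 <= nsum * T by exact: mulr_ge0.
exact: (iter_measurable L0 (boxed_cutoff A (boxed_indJT (lexx (nsum * T))))).
Qed.

Lemma cutoff_integral_bound A y T : 0 <= T ->
  `|cutoff_integral A y T| <= M * (nsum * T) ^+ d.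
Proof.
move=> T0; have L0 : 0 <= nsum * T by exact: mulr_ge0.
exact: (iter_bound y L0 (boxed_cutoff A (boxed_indJT (lexx (nsum * T))))).
Qed.

(* The width for which exp (- delta * layer s) = 2^(- d s) compensates the square of
   the volume of J^(2^s). *)
Definition layer (s : nat) : R := d%:R * ln 2 / delta * s%:R.

(** The term nsum^d comes from the constant part of the correlation bound, once [layer] has
    cancelled one factor of volume; (4 / a)^d comes from the decaying part. *)
Definition moment_const : R := C * (nsum ^+ d + (4 / a) ^+ d).

(** Linearity in the volume is the point: such bounds add up over consecutive intervals without
    loss. *)
Lemma increment_second_moment s T T' : 0 <= T -> T <= T' -> T' <= 2 ^+ s ->
  \int[nu]_y (cutoff_integral (layer s) y T' - cutoff_integral (layer s) y T) ^+ 2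
  <= moment_const * (iter d (indJT T') - iter d (indJT T)).
Proof.
move=> T0 TT' T's; have T'0 := le_trans T0 TT'.
have L0 : 0 <= nsum * T' by exact: mulr_ge0.
under eq_Rintegral => y _ do rewrite cutoff_integralB//.
set B := fun p => indJT T' p - indJT T p.
have nB : boxed d (fun _ : unit => 1) (nsum * T') (fun=> B) by exact: boxed_indJTB.
have B0 p : 0 <= B p by rewrite subr_ge0 le_indJT.
have BR p : B p != 0 -> inRcone m n (emb p).
  rewrite /B /indJT !indicE; case: indJTP => [[]//|h].
  case: indJTP => [[]//|_]; by rewrite subrr eqxx.
have V0 : 0 <= iter d B by exact: iter_ge0.
have VE : iter d B = iter d (indJT T') - iter d (indJT T).
  have := iter_linear 1 tt L0 (boxed_indJT (ler_wpM2l nsum0 TT')) nB; rewrite mul1r => E.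
  apply/eqP; rewrite eq_sym subr_eq addrC -E; apply/eqP.
  by apply: eq_iter => p _; rewrite /B; ring.
rewrite -VE; apply: (le_trans (cutoff_second_moment _ L0 nB B0 BR)).
rewrite ler_wpM2r// /moment_const mulrDr lerD2r -mulrA ler_pM2l//.
(* This factor is 2^(-s d), while the volume of the increment is at most (nsum T')^d <= nsum^d 2^(s
   d). *)
have -> : expR (- delta * layer s) = ((2 ^+ s) ^+ d)^-1.
  rewrite /layer (_ : - delta * _ = - (d * s)%:R * ln 2).
    by rewrite mulNr expRN expRM_natl lnK ?posrE// mulnC exprM.
  by rewrite natrM; field; rewrite gt_eqF.
rewrite mulrC ler_pdivrMr ?exprn_gt0// -exprMn.
apply: (@le_trans _ _ ((nsum * T') ^+ d)).
  rewrite VE (le_trans _ (proj2 (andP (iter_indJT_le T'0))))// gerBl.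
  by have /andP[] := iter_indJT_le T0.
by rewrite lerXn2r ?nnegrE ?mulr_ge0 ?exprn_ge0// ler_wpM2l.
Qed.

End Increments.

Section FiniteSums.
Context {R : realType} dY (Y : measurableType dY) (nu : probability Y R).

Lemma integrable_Rsum N (f : nat -> Y -> R) :
  (forall i, (i < N)%N -> nu.-integrable setT (EFin \o f i)) ->
  nu.-integrable setT (EFin \o (fun y => \sum_(i < N) f i y)).
Proof.
elim: N => [_|N IH fi].
  rewrite (_ : _ \o _ = cst 0%E); first exact: integrable0.
  by apply/funext => y /=; rewrite big_ord0.
rewrite (_ : _ \o _ = (fun y => (\sum_(i < N) f i y)%:E + (f N y)%:E)%E); last first.
  by apply/funext => y /=; rewrite big_ord_recr EFinD.
apply: integrableD => //; last exact: fi.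
by apply: IH => i iN; apply: fi; rewrite ltnS ltnW.
Qed.

Lemma Rintegral_sum N (f : nat -> Y -> R) :
  (forall i, (i < N)%N -> nu.-integrable setT (EFin \o f i)) ->
  \int[nu]_y (\sum_(i < N) f i y) = \sum_(i < N) \int[nu]_y f i y.
Proof.
elim: N => [_|N IH fi].
  under eq_Rintegral => y _ do rewrite big_ord0.
  by rewrite Rintegral_cst// mul0r big_ord0.
have fi' i : (i < N)%N -> nu.-integrable setT (EFin \o f i).
  by move=> iN; apply: fi; rewrite ltnS ltnW.
under eq_Rintegral => y _ do rewrite big_ord_recr.
by rewrite /= RintegralD ?big_ord_recr ?IH//; [exact: integrable_Rsum|exact: fi].
Qed.

End FiniteSums.

(** * Almost sure control of the truncated integrals at integers *)

Section AlmostSure.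
Context {R : realType} (k r : nat) (m : 'I_k -> nat) (n : 'I_r -> nat).
Hypotheses (k0 : (0 < k)%N) (r0 : (0 < r)%N).
Hypotheses (m0 : forall i, (0 < m i)%N) (n0 : forall j, (0 < n j)%N).
Local Notation iter := (@iter_lebesgue R).
Local Notation d := (k + r).-1.
Local Notation indJT := (@indJT R k r m n).
Local Notation nsum := (@nsum R r n).
Context dY (Y : measurableType dY) (nu : probability Y R).
Variables (F : Y * (k + r).-tuple R -> R) (M delta C : R).
Hypotheses (mF : measurable_fun setT F) (FM : forall z, `|F z| <= M).
Hypotheses (delta0 : 0 < delta) (C0 : 0 < C).
Hypothesis mixing : forall h1 h2 : (k + r).-tuple R, inRcone m n h1 -> inRcone m n h2 ->
  `| \int[nu]_x (F (x, h1) * F (x, h2)) | <= C * expR (- delta *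
     Num.min (Num.min (floorv h1) (floorv h2)) (supdist h1 h2)).

Let path s y (N : nat) : R := cutoff_integral m n F (layer k r delta s) y N%:R.
Let K := moment_const k n delta C.
(** A bound for the mean contribution of a single dyadic scale to the energy: [K] times an upper
    bound for the volume of J^(2^s). *)
Let D s : R := K * nsum ^+ d * (2 ^+ s) ^+ d.

Let d_gt0 : (0 < d)%N.
Proof. by case: k r k0 r0 => // k' [|r']// _ _; rewrite addSn addnS. Qed.

Let K0 : 0 < K.
Proof.
rewrite /K /moment_const mulr_gt0// addr_gt0// exprn_gt0//.
  exact: lt_le_trans ltr01 (nsum_ge1 r0 n0).
by rewrite divr_gt0// divr_gt0// ltr0n.
Qed.

Let nsum_gt0 : 0 < nsum. Proof. exact: lt_le_trans ltr01 (nsum_ge1 r0 n0). Qed.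

Let D0 s : 0 < D s.
Proof.
by apply: mulr_gt0; [apply: mulr_gt0 => //; exact: exprn_gt0|rewrite !exprn_gt0].
Qed.

Let M0 (y : Y) : 0 <= M. Proof. exact: le_trans (FM (y, hyp_embed m n [::])). Qed.

Let sqr_incr_integrable s N N' : nu.-integrable setT
  (EFin \o (fun y => (path s y N' - path s y N) ^+ 2)).
Proof.
have mp N'' : measurable_fun setT (fun y => path s y N'').
  exact: (measurable_cutoff_integral r0 m0 n0 mF FM).
apply: (@integrable_prob_bounded _ _ _ _ _
  ((M * (nsum * N'%:R) ^+ d + M * (nsum * N%:R) ^+ d) ^+ 2)).
  by apply: measurable_funX; exact: measurable_funB.
move=> y; rewrite normrX lerXn2r ?nnegrE//.
  by rewrite addr_ge0// mulr_ge0 ?(M0 y)// exprn_ge0// mulr_ge0// ltW.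
rewrite (le_trans (ler_normB _ _))// lerD//.
  exact: (cutoff_integral_bound r0 m0 n0 mF FM).
exact: (cutoff_integral_bound r0 m0 n0 mF FM).
Qed.

Let energy s y := dyadic_energy s (path s y).

Let energy_integrable s : nu.-integrable setT (EFin \o energy s).
Proof.
apply: (integrable_Rsum (f := fun i y => \sum_(j < 2 ^ (s - i))
   (path s y (j.+1 * 2 ^ i)%N - path s y (j * 2 ^ i)%N) ^+ 2)) => i _.
by apply: (integrable_Rsum (f := fun j y =>
   (path s y (j.+1 * 2 ^ i)%N - path s y (j * 2 ^ i)%N) ^+ 2)).
Qed.

Let energy_le s : \int[nu]_y energy s y <= s%:R * D s.
Proof.
rewrite (Rintegral_sum (f := fun i y => \sum_(j < 2 ^ (s - i))
   (path s y (j.+1 * 2 ^ i)%N - path s y (j * 2 ^ i)%N) ^+ 2)); last first.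
  by move=> i _; apply: (integrable_Rsum (f := fun j y =>
   (path s y (j.+1 * 2 ^ i)%N - path s y (j * 2 ^ i)%N) ^+ 2)).
apply: (@le_trans _ _ (\sum_(i < s) D s)); last first.
  by rewrite sumr_const card_ord mulr_natl.
apply: ler_sum => i _.
rewrite (Rintegral_sum (f := fun j y =>
   (path s y (j.+1 * 2 ^ i)%N - path s y (j * 2 ^ i)%N) ^+ 2)); last by [].
pose V N := iter d (indJT N%:R).
have si : (2 ^ (s - i) * 2 ^ i = 2 ^ s)%N by rewrite -expnD subnK// ltnW.
apply: (@le_trans _ _ (\sum_(j < 2 ^ (s - i)) K * (V (j.+1 * 2 ^ i)%N - V (j * 2 ^ i)%N))).
  apply: ler_sum => j _.
  apply: (increment_second_moment k0 r0 m0 n0 mF FM delta0 C0 mixing) => //.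
    by rewrite ler_nat leq_mul2r leqnSn orbT.
  by rewrite -natrX ler_nat -si leq_mul2r ltn_ord orbT.
rewrite -mulr_sumr -(big_mkord xpredT (fun j => V (j.+1 * 2 ^ i)%N - V (j * 2 ^ i)%N)).
(* At every scale the volumes telescope to that of J^(2^s), so all [s] scales obey the same
   bound. *)
rewrite (telescope_sumr (fun j => V (j * 2 ^ i)%N))// /D -mulrA ler_pM2l// si mul0n.
have /andP[_] := iter_indJT_le r0 m0 n0 (ler0n R (2 ^ s)).
have /andP[+ _] := iter_indJT_le r0 m0 n0 (lexx (0 : R)).
rewrite -exprMn natrX /V => h1 h2; rewrite (le_trans _ h2)// natrX gerBl//.
Qed.

Lemma cutoff_ae_bound (eps : R) : 0 < eps ->
  {ae nu, forall y, exists M', forall s N, (N < 2 ^ s)%N ->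
    cutoff_integral m n F (layer k r delta s) y N%:R ^+ 2 <=
    M' * s.+2%:R `^ (3 + eps) * (2 ^+ s) ^+ d}.
Proof.
move=> eps0.
(* With this weight the mean of [X s] is at most eps (s + 2)^(-1 - eps) s / (s + 2), hence at most
   [u s - u s.+1] by [powRN_telescope] at x = s + 1. *)
pose c s : R := eps * s.+2%:R `^ (- (2 + eps)) / D s.
have c0 s : 0 < c s by rewrite /c divr_gt0// mulr_gt0// powR_gt0.
pose X s y := c s * energy s y.
pose u s : R := s.+1%:R `^ (- eps).
have ae : {ae nu, forall y, exists M, forall s, X s y <= M}.
  apply: (@ae_bounded _ _ _ nu X u).
  - move=> s; rewrite (_ : _ \o _ = fun y => ((c s)%:E * (energy s y)%:E)%E).
      by apply: integrableZl => //; exact: (energy_integrable s).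
    by apply/funext => y /=; rewrite EFinM.
  - move=> s y; rewrite mulr_ge0 ?(ltW (c0 s))//.
    by apply: sumr_ge0 => i _; apply: sumr_ge0 => j _; exact: sqr_ge0.
  - by move=> s; exact: powR_ge0.
  move=> s; rewrite /X RintegralZl//.
  apply: (le_trans (ler_wpM2l (ltW (c0 s)) (energy_le s))).
  have := powRN_telescope eps0 (ltr0Sn R s); rewrite natr1.
  apply: le_trans; rewrite /c (_ : - (2 + eps) = - (1 + eps) + - 1); last by ring.
  rewrite powRD; last by rewrite pnatr_eq0 implybT.
  rewrite powR_inv1//; set p := _ `^ _.
  rewrite [leLHS](_ : _ = eps * p * (s%:R / s.+2%:R)); last first.
    have : s.+2%:R != 0 :> R by rewrite pnatr_eq0.
    by move: (s.+2%:R : R) => w w0; field; rewrite w0 gt_eqF.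
  rewrite -[leRHS]mulr1 ler_wpM2l ?mulr_ge0 ?powR_ge0 ?(ltW eps0)//.
  by rewrite ler_pdivrMr// mul1r ler_nat -addn2 leq_addr.
apply: filterS ae => y [M1 XM].
exists (`|M1| * (K * nsum ^+ d) / eps) => s N Ns.
(* The path starts at 0 because the enclosing cube has side 0 and [d] is positive. *)
have p00 : path s y 0%N = 0.
  have := cutoff_integral_bound r0 m0 n0 mF FM (layer k r delta s) y (lexx 0).
  rewrite mulr0 expr0n (gtn_eqF d_gt0) mulr0 normr_le0 => /eqP; exact.
have := dyadic_chaining (path s y) Ns; rewrite p00 subr0 => h.
apply: (le_trans h); rewrite -/(energy s y).
have e0 : 0 <= energy s y.
  by apply: sumr_ge0 => i _; apply: sumr_ge0 => j _; exact: sqr_ge0.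
have e1 : energy s y <= `|M1| / c s.
  by rewrite ler_pdivlMr// mulrC (le_trans (XM s))// ler_norm.
(* The chaining factor [s] is enlarged to [s.+2] and joins the exponent 2 + eps of the weight: this
   gives 3 + eps. *)
apply: (@le_trans _ _ (s.+2%:R * (`|M1| / c s))).
  by apply: ler_pM => //; rewrite ler_nat -addn2 leq_addr.
rewrite (_ : 3 + eps = 1 + (2 + eps)); last by ring.
rewrite powRD; last by rewrite pnatr_eq0 implybT.
rewrite powRr1// /c powRN /D.
set p := s.+2%:R `^ _; have p0 : 0 < p by rewrite powR_gt0.
rewrite le_eqVlt; apply/orP; left; apply/eqP; field.
by rewrite !gt_eqF ?exprn_gt0.
Qed.
End AlmostSure.

Section IterSums.
Context {R : realType}.
Local Notation iter := (@iter_lebesgue R).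

Lemma boxed_sum (I : Type) (s : seq I) d L (G : I -> seq R -> R) :
  (forall i, boxed d (fun _ : unit => 1) L (fun=> G i)) ->
  boxed d (fun _ : unit => (size s)%:R) L (fun=> fun p => \sum_(i <- s) G i p).
Proof.
move=> nG; split => [||_ p sp] //.
  by apply: measurable_sum => i; case: (nG i).
elim: s => [|i s IH]; first by rewrite big_nil normr0 mul0r.
rewrite big_cons /= -nat1r mulrDl (le_trans (ler_normD _ _))// lerD//.
by case: (nG i) => _ _; exact.
Qed.

Lemma iter_sum (I : Type) (s : seq I) d L (G : I -> seq R -> R) : 0 <= L ->
  (forall i, boxed d (fun _ : unit => 1) L (fun=> G i)) ->
  iter d (fun p => \sum_(i <- s) G i p) = \sum_(i <- s) iter d (G i).
Proof.
move=> L0 nG; elim: s => [|i s IH].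
  by rewrite big_nil -[RHS](iter0 d); apply: eq_iter => p _; rewrite big_nil.
rewrite big_cons -IH -[X in X + _]mul1r.
rewrite -(iter_linear 1 tt L0 (nG i) (boxed_sum s nG)).
by apply: eq_iter => p _; rewrite big_cons mul1r.
Qed.

Lemma iter_norm_le dZ (Z : measurableType dZ) d (b c : Z -> R) (L : R) G H z : 0 <= L ->
  boxed d b L G -> boxed d c L H ->
  (forall p, size p = d -> `|G z p| <= H z p) -> `|iter d (G z)| <= iter d (H z).
Proof.
move=> L0 nG nH GH; rewrite ler_norml; apply/andP; split; last first.
  by apply: (iter_le L0 nG nH) => p sp; rewrite (le_trans (ler_norm _))// GH.
rewrite lerNl -mulN1r -(iterZ _ z L0 nG).
have mN : measurable_fun setT (fun _ : Z => - 1 : R) by [].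
have nNG := boxed_mull mN (fun=> lexx _) nG.
apply: (iter_le L0 nNG nH) => p sp.
by rewrite mulN1r (le_trans _ (GH p sp))// -normrN ler_norm.
Qed.

End IterSums.

(** * Boundary layers and the passage from real T to integers *)

Section Boundary.
Context {R : realType} (k r : nat) (m : 'I_k -> nat) (n : 'I_r -> nat).
Hypotheses (k0 : (0 < k)%N) (r0 : (0 < r)%N).
Hypotheses (m0 : forall i, (0 < m i)%N) (n0 : forall j, (0 < n j)%N).
Local Notation iter := (@iter_lebesgue R).
Local Notation d := (k + r).-1.
Local Notation emb := (@hyp_embed R k r m n).
Local Notation indJT := (@indJT R k r m n).
Local Notation inner := (@inner R k r m n).
Local Notation nsum := (@nsum R r n).
Context dY (Y : measurableType dY).
Variables (F : Y * (k + r).-tuple R -> R) (M : R).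
Hypotheses (mF : measurable_fun setT F) (FM : forall z, `|F z| <= M).

Let nsum0 : 0 <= nsum. Proof. exact: le_trans ler01 (nsum_ge1 r0 n0). Qed.

Let coord_slab (T v g : R) i p : R :=
  box (nsum * T) p * (`|tnth (emb p) i - g| <= v)%R%:R.

Let boxed_coord_slab T v g i :
  boxed d (fun _ : unit => 1) (nsum * T) (fun=> coord_slab T v g i).
Proof.
apply: boxed_box => // [|_ p _]; last by rewrite ger0_norm ?lern1 ?leq_b1.
apply: measurable_natr_bool; apply: measurable_fun_ler => //.
apply: measurableT_comp => //; apply: measurable_funB => //.
exact: (measurableT_comp (measurable_tnth i) (@measurable_hyp_embed R k r m n _ unit)).
Qed.

(** Coordinates are nonnegative on the cone, so threshold 0 truncates nothing. The full integral
    thus has the same form as the truncated ones and can be compared with them under one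
    integral. *)
Lemma cutoff_integral0 y T :
  cutoff_integral m n F 0 y T = iter d (fun p => F (y, emb p) * indJT T p).
Proof.
apply: eq_iter => p _; congr (_ * _); rewrite /indJT /inner indicE.
case: indJTP => [[[h _] _]|_]; last by rewrite mulr0.
by case: forallP => [_|[]]; [rewrite mulr1|exact: h].
Qed.

(** A point of J^T that is lost either has a coordinate in [0, A], a slab about 0 of half-width [A],
    or has some s_j in the interval from [N] to [T], inside a slab about [N] of half-width 1. *)
Lemma indJTB_le_slabs A N T p : 0 <= A -> N <= T -> T <= N + 1 -> size p = d ->
  0 <= inner 0 p * indJT T p - inner A p * indJT N p <=
  \sum_i (coord_slab T A 0 i p + coord_slab T 1 N i p).
Proof.
move=> A0 NT TN sp.
have slab_ge0 v g i : 0 <= coord_slab T v g i p by rewrite mulr_ge0 ?box_ge0.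
have S0 : 0 <= \sum_i (coord_slab T A 0 i p + coord_slab T 1 N i p).
  by apply: sumr_ge0 => i _; rewrite addr_ge0.
have slab_le i : coord_slab T A 0 i p + coord_slab T 1 N i p <=
    \sum_i (coord_slab T A 0 i p + coord_slab T 1 N i p).
  by rewrite (bigD1 i)//= lerDl; apply: sumr_ge0 => j _; rewrite addr_ge0.
have [jT0|jT1] : indJT T p = 0 \/ indJT T p = 1.
- by rewrite /indJT indicE; case: (_ \in _); [right|left].
- have jN0 : indJT N p = 0.
    apply/eqP; rewrite eq_le indJT_ge0 andbT -jT0; exact: le_indJT.
  by rewrite jT0 jN0 !mulr0 subrr lexx.
have hT : inJT m n T (emb p).
  by move: jT1; rewrite /indJT indicE; case: indJTP => // _ /eqP; rewrite eq_sym oner_eq0.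
have b1 : box (nsum * T) p = 1.
  by apply/le_anti; rewrite box_le1 -jT1 indJT_le_box.
case: (hT) => -[h0 _] hs.
have -> : inner 0 p = 1 by rewrite /inner; case: forallP.
rewrite jT1 mul1r; apply/andP; split.
  by rewrite subr_ge0 mulr_ile1 ?inner_ge0 ?inner_le1 ?indJT_ge0 ?indJT_le1.
rewrite /inner; case: forallP => [hA|/existsNP[i /negP]].
  rewrite mul1r /indJT indicE; case: indJTP => [_|]; first by rewrite subrr.
  move=> hN; rewrite subr0.
  have [j /negP jN] : exists j, ~ scoord (emb p) j <= N.
    by apply/existsNP => hN'; apply: hN; split => //; case: hT.
  apply: le_trans (slab_le (rshift k j)); rewrite -[leLHS]add0r lerD//.
  rewrite /coord_slab b1 mul1r /=; move: jN; rewrite -ltNge => jN.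
  rewrite ger0_norm ?subr_ge0 ?(ltW jN)//.
  by rewrite lerBlDl (le_trans (hs j))// addrC.
rewrite -ltNge => iA; rewrite mul0r subr0.
apply: le_trans (slab_le i); rewrite -[leLHS]addr0 lerD//.
by rewrite /coord_slab b1 mul1r /= subr0 ger0_norm ?h0// (ltW iA).
Qed.

(** Only the bound on F and the volumes of slabs enter, so the estimate holds for every [y], with
    one constant. *)
Lemma boundary_layer : exists2 kappa : R, 0 <= kappa &
  forall y (A N T : R), 0 <= A -> 0 <= N -> N <= T -> T <= N + 1 ->
  `|iter d (fun p => F (y, emb p) * indJT T p) - cutoff_integral m n F A y N| <=
  kappa * (A + 1) * T ^+ d.-1.
Proof.
have [kap kap0 slabP] := @iter_coord_slab R k r m n k0 r0 m0 n0.
exists (`|M| * (\sum_(i < k + r) kap) * nsum ^+ d.-1).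
  by rewrite !mulr_ge0 ?exprn_ge0// sumr_ge0.
move=> y A N T A0 N0 NT TN; have T0 := le_trans N0 NT.
have L0 : 0 <= nsum * T by exact: mulr_ge0.
rewrite -cutoff_integral0 /cutoff_integral.
have nT := boxed_cutoff m n mF FM 0 (boxed_indJT r0 m0 n0 (lexx (nsum * T))).
have nN := boxed_cutoff m n mF FM A (boxed_indJT r0 m0 n0 (ler_wpM2l nsum0 NT)).
have := iter_linear (- 1) y L0 nN nT; rewrite mulN1r addrC => <-.
pose S v g p := \sum_i coord_slab T v g i p.
have nS v g := boxed_sum (index_enum _) (boxed_coord_slab T v g).
have iS v g : 0 <= v -> iter d (S v g) <= (\sum_(i < k + r) kap) * v * (nsum * T) ^+ d.-1.
  move=> v0; rewrite /S (iter_sum _ L0 (boxed_coord_slab T v g)) mulr_suml mulr_suml.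
  by apply: ler_sum => i _; exact: slabP.
have nSS := boxed_linear 1 (nS A 0) (nS 1 N).
have mM : measurable_fun setT (fun _ : unit => `|M|) by [].
have nB := boxed_mull mM (fun=> lexx _) nSS.
have mtt : measurable_fun setT (fun _ : Y => tt) by [].
have bound := iter_norm_le (z := y) L0 (boxed_linear (- 1) nN nT) (boxed_comp mtt nB).
apply: (le_trans (bound _)) => [p sp|].
  rewrite /= mul1r mulN1r addrC -mulrBr normrM ler_pM//.
    by rewrite (le_trans (FM _))// ler_norm.
  have := indJTB_le_slabs A0 NT TN sp; rewrite big_split => /andP[h1 h2].
  by rewrite ger0_norm.
rewrite /= (iterZ _ tt L0 nSS) (iter_linear 1 tt L0 (nS A 0) (nS 1 N)) mul1r.
rewrite -!mulrA ler_wpM2l//.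
apply: (le_trans (lerD (iS A 0 A0) (iS 1 N ler01))).
by rewrite exprMn; set K := \sum_(i < _) _; rewrite le_eqVlt; apply/orP; left; apply/eqP; ring.
Qed.

End Boundary.

(** * Asymptotics *)

Section Asymptotics.
Context {R : realType}.

(** [N] is the integer part of [T], and [s] exceeds the integer part of its binary logarithm by one,
    so 2^s <= 2 N. Then s + 2 <= 3 + ln T / ln 2, and ln T >= 1 absorbs the 3. *)
Lemma dyadic_scale (T : R) : expR 1 <= T -> exists s N : nat,
  [/\ (N < 2 ^ s)%N, N%:R <= T, T <= N%:R + 1, 2 ^+ s <= 2 * T &
      s.+2%:R <= (3 + (ln 2)^-1) * ln T].
Proof.
move=> eT; have T1 : 1 <= T by rewrite (le_trans _ eT)// -expR0 ler_expR.
have T0 : 0 < T by exact: lt_le_trans T1.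
have l1 : 1 <= ln T by rewrite -(expRK 1) ler_ln ?posrE ?expR_gt0.
have l2 : 0 < ln 2 :> R by rewrite ln_gt0// ltr1n.
pose N := Num.trunc T; pose s := (trunc_log 2 N).+1.
have /andP[NT TN] := truncn_itv (ltW T0).
have N0 : (0 < N)%N by rewrite /N truncn_gt0.
have sT : 2 ^+ s <= 2 * T.
  rewrite exprS ler_pM2l// (le_trans _ NT)// -natrX ler_nat; exact: trunc_logP.
exists s, N; split => //; first exact: trunc_log_ltn.
  by rewrite natr1 ltW.
have : s%:R * ln 2 <= ln 2 + ln T.
  by rewrite -lnM ?posrE// -ler_expR expRM_natl !lnK ?posrE// mulr_gt0.
rewrite -ler_pdivlMr// mulrDl mulfV ?gt_eqF// => sl.
rewrite -addn2 natrD mulrDl; have : 0 <= (ln T - 1) * 3 by lra.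
by move: sl; rewrite [_ / ln 2]mulrC; move: ((ln 2)^-1 * ln T) => w; lra.
Qed.

Variables (k r : nat).
Hypotheses (k0 : (0 < k)%N) (r0 : (0 < r)%N).
Local Notation d := (k + r).-1.

Definition rate (eps T : R) : R := if (2 < k + r)%N
  then T^-1 * (ln T) `^ (3 / 2 + r%:R + eps)
  else T `^ (- (1 / 2)) * (ln T) `^ (3 / 2 + eps).

Lemma rate_ge0 eps T : 0 <= T -> 0 <= rate eps T.
Proof.
move=> T0; rewrite /rate; case: ifP => _; rewrite mulr_ge0 ?powR_ge0// invr_ge0//.
Qed.

(** Here the two regimes separate. If [d] is at least 2, then T^(-d) <= T^(-2); if [d] is 1, the two
    sides agree. *)
Lemma sqr_rate_ge eps T : 0 < eps -> 1 <= T -> 1 <= ln T ->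
  T ^- d * ln T `^ (3 + 2 * eps) <= rate eps T ^+ 2.
Proof.
move=> eps0 T1 l1; have T0 : 0 < T by exact: lt_le_trans T1.
have sq x (y : R) : (x `^ y) ^+ 2 = x `^ (y * 2).
  by rewrite powRrM powR_mulrn ?powR_ge0.
rewrite /rate; case: ifPn => [kr2|kr2]; rewrite exprMn !sq.
  apply: ler_pM => //; rewrite ?powR_ge0 ?invr_ge0 ?exprn_ge0 ?(ltW T0)//.
    rewrite exprVn lef_pV2 ?posrE ?exprn_gt0//; apply: ler_weXn2l => //.
    by rewrite -ltnS prednK// addn_gt0 k0.
  apply: ler_powR => //.
  have := ler0n R r; lra.
have -> : d = 1%N.
  by case: k r k0 r0 kr2 => [|[|k']]// [|[|r']]// _ _; rewrite ?addnS ?addSn.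
rewrite (_ : - (1 / 2) * 2 = - 1 :> R); last by lra.
rewrite powR_inv1 ?(ltW T0)// expr1 (_ : (3 / 2 + eps) * 2 = 3 + 2 * eps)//; lra.
Qed.

(** Serves the boundary layers, whose share T^(-1) log T must be below the rate in both regimes. *)
Lemma rate_ge eps T : 0 < eps -> 1 <= T -> 1 <= ln T ->
  T^-1 * ln T `^ (3 / 2 + eps) <= rate eps T.
Proof.
move=> eps0 T1 l1; have T0 : 0 < T by exact: lt_le_trans T1.
rewrite /rate; case: ifPn => [kr2|kr2].
  rewrite ler_wpM2l ?invr_ge0 ?(ltW T0)//; apply: ler_powR => //.
  have := ler0n R r; lra.
rewrite ler_wpM2r ?powR_ge0// -[T^-1]powR_inv1 ?(ltW T0)//; apply: ler_powR => //; lra.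
Qed.

Lemma asymptotic_bound (I : R -> R) (a : nat -> nat -> R) (kappa lam B eps : R) :
  0 < eps -> 0 <= kappa -> 0 <= lam ->
  (forall s N T, N%:R <= T -> T <= N%:R + 1 ->
     `|I T - a s N| <= kappa * (lam * s%:R + 1) * T ^+ d.-1) ->
  (forall s N, (N < 2 ^ s)%N ->
     a s N ^+ 2 <= B * s.+2%:R `^ (3 + eps) * (2 ^+ s) ^+ d) ->
  exists2 K, 0 <= K & forall T, expR 1 <= T ->
    `|T ^- d * I T| <= K * (ln T `^ (- (eps / 2)) * rate eps T).
Proof.
move=> eps0 kap0 lam0 Ia aB.
pose c : R := 3 + (ln 2)^-1.
have l2 : 0 < ln 2 :> R by rewrite ln_gt0// ltr1n.
have c3 : 3 < c by rewrite /c ltrDl invr_gt0.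
(* The powers of [c] and 2 come from s + 2 <= c ln T and 2^s <= 2 T. *)
pose B' := `|B| * c `^ (3 + eps) * 2 ^+ d.
have B'0 : 0 <= B' by rewrite !mulr_ge0 ?powR_ge0 ?exprn_ge0.
pose K1 := kappa * (lam * c + 1).
have K10 : 0 <= K1 by rewrite mulr_ge0// addr_ge0// mulr_ge0// ltW// (lt_trans _ c3).
exists (Num.sqrt B' + K1); first by rewrite addr_ge0// sqrtr_ge0.
move=> T eT; have [s [N [Ns NT TN sT sc]]] := dyadic_scale eT.
have T1 : 1 <= T by rewrite (le_trans _ eT)// -expR0 ler_expR.
have T0 : 0 < T by exact: lt_le_trans T1.
have l1 : 1 <= ln T by rewrite -(expRK 1) ler_ln ?posrE ?expR_gt0.
have l0 : 0 < ln T by exact: lt_le_trans l1.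
set l := ln T in sc l1 l0 *.
have g0 := rate_ge0 eps (ltW T0).
have t0 : 0 <= l `^ (- (eps / 2)) by exact: powR_ge0.
have -> : I T = a s N + (I T - a s N) by ring.
rewrite mulrDr (le_trans (ler_normD _ _))// mulrDl lerD//.
  (* The truncated part is compared through squares, the form in which the chaining bound is
     given. *)
  rewrite -ler_sqr ?nnegrE ?mulr_ge0 ?sqrtr_ge0//.
  rewrite !exprMn sqr_sqrtr// real_normK ?num_real// exprMn.
  have aNs : a s N ^+ 2 <= B' * l `^ (3 + eps) * T ^+ d.
    apply: (le_trans (aB _ _ Ns)).
    apply: (@le_trans _ _ (`|B| * (c * l) `^ (3 + eps) * (2 * T) ^+ d)); last first.
      rewrite powRM ?(ltW l0) ?(le_trans _ (ltW c3))// exprMn /B'.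
      by rewrite le_eqVlt; apply/orP; left; apply/eqP; ring.
    apply: (@le_trans _ _ (`|B| * s.+2%:R `^ (3 + eps) * (2 ^+ s) ^+ d)).
      by rewrite ler_wpM2r ?exprn_ge0// ler_wpM2r ?powR_ge0// ler_norm.
    apply: ler_pM; rewrite ?mulr_ge0 ?powR_ge0 ?exprn_ge0//.
      rewrite ler_wpM2l//; apply: ge0_ler_powR => //.
      - by rewrite addr_ge0// ltW.
      - by rewrite nnegrE.
      - by rewrite nnegrE mulr_ge0// ltW// (lt_trans _ c3).
    by rewrite lerXn2r ?nnegrE ?exprn_ge0 ?mulr_ge0 ?(ltW T0).
  apply: (@le_trans _ _ (B' * (l `^ (- eps) * (T ^- d * l `^ (3 + 2 * eps))))).
    apply: (@le_trans _ _ ((T ^- d) ^+ 2 * (B' * l `^ (3 + eps) * T ^+ d))).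
      by rewrite ler_wpM2l// sqr_ge0.
    (* The gain l^(-eps) is split off; its root is the factor that tends to 0. *)
    rewrite (_ : l `^ (3 + eps) = l `^ (- eps) * l `^ (3 + 2 * eps)).
      rewrite le_eqVlt; apply/orP; left; apply/eqP; field.
      by rewrite expf_neq0// gt_eqF.
    rewrite -powRD ?(gt_eqF l0) ?implybT//; congr (_ `^ _); ring.
  rewrite ler_wpM2l// -(powR_mulrn 2 t0) -powRrM.
  rewrite (_ : - (eps / 2) * 2 = - eps); last by field.
  by rewrite ler_wpM2l ?powR_ge0// sqr_rate_ge.
rewrite normrM ger0_norm; last by rewrite invr_ge0 exprn_ge0// ltW.
apply: (@le_trans _ _ (T ^- d * (kappa * (lam * s%:R + 1) * T ^+ d.-1))).
  by rewrite ler_wpM2l ?invr_ge0 ?exprn_ge0 ?(ltW T0)//; exact: Ia.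
have d1 : T ^- d * T ^+ d.-1 = T^-1.
  have : (0 < d)%N by case: k r k0 r0 => // k' [|r'] // _ _; rewrite addSn addnS.
  case: (d) => [//|e] _ /=; rewrite exprS; field.
  by rewrite expf_neq0 ?gt_eqF.
rewrite mulrCA d1.
apply: (@le_trans _ _ (K1 * l * T^-1)).
  rewrite ler_wpM2r ?invr_ge0 ?(ltW T0)// /K1 -mulrA ler_wpM2l//.
  have sl : s%:R <= c * l by rewrite (le_trans _ sc)// ler_nat -addn2 leq_addr.
  rewrite mulrDl mul1r -mulrA lerD// ler_wpM2l//.
rewrite -mulrA ler_wpM2l//.
apply: (le_trans _ (ler_wpM2l t0 (rate_ge eps0 T1 l1))).
rewrite mulrC mulrCA ler_wpM2l ?invr_ge0 ?(ltW T0)//.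
rewrite -powRD ?(gt_eqF l0) ?implybT// -[leLHS]powRr1 ?(ltW l0)//.
(* The boundary part needs only 1 <= 3/2 + eps/2 in the exponent of ln T. *)
apply: ler_powR => //; lra.
Qed.

End Asymptotics.

Theorem theoremA1 (R : realType) (k r : nat) (m : 'I_k -> nat) (n : 'I_r -> nat)
  (d : measure_display) (Y : measurableType d) (nu : probability Y R)
  (F : Y * (k + r).-tuple R -> R) :
  (0 < k)%N -> (0 < r)%N ->
  (forall i, (0 < m i)%N) -> (forall j, (0 < n j)%N) ->
  measurable_fun setT F ->
  (exists M : R, forall z, `|F z| <= M) ->
  (exists delta C : R, 0 < delta /\ 0 < C /\
     forall h1 h2 : (k + r).-tuple R, inRcone m n h1 -> inRcone m n h2 ->
       `| Rintegral nu setT (fun x => F (x, h1) * F (x, h2)) |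
         <= C * expR (- delta *
              Num.min (Num.min (floorv h1) (floorv h2)) (supdist h1 h2))) ->
  forall eps : R, 0 < eps ->
  {ae nu, forall y,
     (fun T : R => T ^- (k + r).-1 * JT_integral m n T (fun h => F (y, h)))
       =o_ (Rpinfty R)
     (fun T : R => if (2 < k + r)%N
      then T^-1 * (ln T) `^ (3 / 2 + r%:R + eps)
      else T `^ (- (1 / 2)) * (ln T) `^ (3 / 2 + eps))}.
Proof.
move=> k0 r0 m0 n0 mF [M FM] [delta [C [delta0 [C0 mixing]]]] eps eps0.
have ae := cutoff_ae_bound k0 r0 m0 n0 mF FM delta0 C0 mixing eps0.
apply: filterS ae => y [B cutB].
have [kappa kappa0 layerP] := boundary_layer k0 r0 m0 n0 mF FM.
have lam0 : 0 <= (k + r).-1%:R * ln 2 / delta :> R.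
  by rewrite divr_ge0 ?(ltW delta0)// mulr_ge0// ln_ge0// ler1n.
pose I T := iter_lebesgue (k + r).-1 (fun p => F (y, hyp_embed m n p) * indJT m n T p).
pose a s N := cutoff_integral m n F (layer k r delta s) y N%:R.
have [K K0 IK] : exists2 K, 0 <= K & forall T, expR 1 <= T ->
    `|T ^- (k + r).-1 * I T| <= K * (ln T `^ (- (eps / 2)) * rate k r eps T).
  apply: (asymptotic_bound k0 r0 (a := a) eps0 kappa0 lam0 _ cutB) => s N T NT TN.
  by apply: layerP => //; rewrite mulr_ge0.
(* The area factor of the parametrization, constant in T. *)
pose c0 : R := Num.sqrt (\sum_(i < k + r) weight R m n i ^+ 2) / `|wlast R m n|.
have c00 : 0 <= c0 by rewrite divr_ge0// sqrtr_ge0.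
apply/eqoP => eta eta0.
(* Chosen so that c0 K tau <= eta; the added 1 keeps the denominator positive. *)
pose tau := eta / (c0 * K + 1).
have tau0 : 0 < tau by rewrite divr_gt0// ltr_wpDl// mulr_ge0.
(* Beyond ln T >= b, the entry 1 gives T >= e, and the other entry gives (ln T)^(-eps/2) <= tau. *)
pose b := Num.max 1 (tau `^ (- (2 / eps))).
near=> T.
have bT : expR b <= T by near: T; apply: nbhs_pinfty_ge; exact: num_real.
have eT : expR 1 <= T by rewrite (le_trans _ bT)// ler_expR le_max lexx.
have T0 : 0 < T by rewrite (lt_le_trans _ eT)// expR_gt0.
have lb : b <= ln T by rewrite -ler_expR lnK.
rewrite -/(rate k r eps T) (ger0_norm (rate_ge0 _ _ _ (ltW T0))).
have -> : T ^- (k + r).-1 * JT_integral m n T (fun h => F (y, h)) =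
  c0 * (T ^- (k + r).-1 * I T) by rewrite mulrCA.
rewrite normrM (ger0_norm c00).
apply: (le_trans (ler_wpM2l c00 (IK T eT))).
have lt : ln T `^ (- (eps / 2)) <= tau.
  have lT0 : 0 < ln T by rewrite (lt_le_trans _ lb)// lt_max ltr01.
  rewrite powRN -[leRHS]invrK lef_pV2 ?posrE ?invr_gt0 ?powR_gt0//.
  have -> : tau^-1 = (tau `^ (- (2 / eps))) `^ (eps / 2).
    rewrite -powRrM (_ : - (2 / eps) * (eps / 2) = - 1) ?powR_inv1 ?(ltW tau0)//.
    by field; rewrite gt_eqF.
  apply: ge0_ler_powR; rewrite ?nnegrE ?powR_ge0 ?(ltW lT0) ?divr_ge0 ?(ltW eps0)//.
  by rewrite (le_trans _ lb)// le_max lexx orbT.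
rewrite !mulrA ler_wpM2r ?rate_ge0 ?(ltW T0)//.
apply: (@le_trans _ _ (c0 * K * tau)).
  by rewrite ler_wpM2l// mulr_ge0.
rewrite /tau mulrCA ler_piMr ?(ltW eta0)// ler_pdivrMr ?mul1r ?lerDl//.
by rewrite ltr_wpDl// mulr_ge0.
Unshelve. all: by end_near.
Qed.
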